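(* Let $p$ be a prime, let $A\subseteq \mathbb{Z}/p\mathbb{Z}$ be a nonempty subset, and write $|2A|=2|A|+r$. Let $\alpha\approx 0.136861$ be the unique real root of the cubic $4x^3+9x^2+6x-1$. Suppose that $$|2A|\leq (2+\alpha)|A|-3\qquad\text{and}\qquad |2A|\leq \tfrac34 p.$$ Then there exist arithmetic progressions $P_A,P_{2A}\subseteq \mathbb{Z}/p\mathbb{Z}$ with the same common difference such that $A\subseteq P_A$, $|P_A|\leq |A|+r+1$, $P_{2A}\subseteq 2A$, and $|P_{2A}|\geq 2|A|-1$.
   Context: For $A\subseteq \mathbb{Z}/p\mathbb{Z}$, $2A=A+A=\{x+y: x,y\in A\}$. An arithmetic progression in $\mathbb{Z}/p\mathbb{Z}$ with difference $g\neq 0$ is a set of the form $\{a, a+g, a+2g,\dots,a+(k-1)g\}$ with $1\le k\le p$. *)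

(* Defs.v *)
From HB Require Import structures.
From mathcomp Require Import all_boot all_order all_algebra.
Set Implicit Arguments. Unset Strict Implicit. Unset Printing Implicit Defensive.
Import Order.TTheory GRing.Theory Num.Theory.

Definition sumset (p : nat) (A : {set 'Z_p}) : {set 'Z_p} :=
  [set x + y | x in A, y in A]%R.

(* P is an arithmetic progression {a, a+g, ..., a+(k-1)g} with 1 <= k <= p
   and difference g (the caller requires g != 0). *)
Definition is_AP (p : nat) (g : 'Z_p) (P : {set 'Z_p}) : Prop :=
  exists (a : 'Z_p) (k : nat),
    (1 <= k <= p)%N /\ P = [set (a + g *+ (val i))%R | i : 'I_k].

(* Main.v *)
Require Import Defs.
From HB Require Import structures.
From mathcomp Require Import all_boot all_order all_algebra.
From mathcomp Require Import zify ring lra.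
From mathcomp Require Import Rstruct reals trigo.
Import Order.TTheory GRing.Theory Num.Theory.
Set Implicit Arguments. Unset Strict Implicit. Unset Printing Implicit Defensive.

(* Write N = |A|, T = |2A|. Every nonzero Fourier coefficient of A is at most
   2a - N, where a is the largest number of elements of A in an arithmetic
   progression of length (p+1)/2: the coefficient is, up to normalisation, a
   Fourier coefficient of the counts in half-circles. Together with Parseval and
   the count N^2 of the solutions of x + y = z in A x A x 2A this yields
   (2a - N)^2 T (p - N) >= N^3 (p - T), and the choice of alpha turns it into
   3a >= T + 4. The extremal part A' of A is Freiman isomorphic to a set of
   integers, and |2A'| <= 3|A'| - 4, so by Freiman's theorem A' lies in a short
   progression while 2A' contains a progression of length 2a - 1. Hence the
   complement C of 2A lies in a progression of length p - 2a + 1 with the same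
   difference, so that A' and -C are again sets of integers. As A' - C misses
   -A, its size is small enough for A' - C to contain a progression of length
   a + |C| - 1, which confines all of A to a progression of length at most
   (p+1)/2. Freiman's theorem, now applied to A itself, concludes. *)

(** * Counting in finite sets of natural numbers *)

Definition cnt (A : pred nat) (l u : nat) : nat := \sum_(l <= i < u) A i.

(** The search stops at [a = x]: beyond it the truncated [x - a] is 0, and [B 0] would produce false
    sums. *)
Definition addp (A B : pred nat) : pred nat :=
  fun x => has (fun a => A a && B (x - a)) (iota 0 x.+1).

Lemma addpP (A B : pred nat) x :
  reflect (exists a b, [/\ A a, B b & a + b = x]) (addp A B x).
Proof.
apply: (iffP hasP) => [[a]|[a [b [Aa Bb <-]]]].
  rewrite mem_iota => lea /andP[Aa Bxa]; exists a, (x - a); split=> //; lia.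
by exists a; [rewrite mem_iota; lia | rewrite Aa addKn Bb].
Qed.

Lemma addpI (A B : pred nat) a b : A a -> B b -> addp A B (a + b).
Proof. by move=> Aa Bb; apply/addpP; exists a, b. Qed.

Lemma addpC (A B : pred nat) : addp A B =1 addp B A.
Proof.
move=> x; apply/addpP/addpP => [] [a [b [Aa Bb <-]]]; exists b, a;
by split=> //; rewrite addnC.
Qed.

Lemma cnt_geq (A : pred nat) l u : u <= l -> cnt A l u = 0.
Proof. by move=> leul; rewrite /cnt big_geq. Qed.

Lemma cnt_cat (A : pred nat) l k u : l <= k -> k <= u ->
  cnt A l u = cnt A l k + cnt A k u.
Proof. by move=> h1 h2; rewrite /cnt (big_cat_nat h1 h2). Qed.

Lemma cntS (A : pred nat) l u : l <= u -> cnt A l u.+1 = cnt A l u + A u.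
Proof. by move=> h; rewrite /cnt big_nat_recr. Qed.

Lemma cnt_recl (A : pred nat) l u : l < u -> cnt A l u = A l + cnt A l.+1 u.
Proof. by move=> h; rewrite /cnt big_ltn. Qed.

Lemma leq_sum_nat_cond (F G : nat -> nat) l u :
  (forall x, l <= x < u -> F x <= G x) ->
  \sum_(l <= x < u) F x <= \sum_(l <= x < u) G x.
Proof.
move=> h; rewrite big_nat_cond [X in _ <= X]big_nat_cond.
by apply: leq_sum => i /andP[/h].
Qed.

Lemma sum1_nat l u : \sum_(l <= i < u) 1 = u - l.
Proof. by rewrite sum_nat_const_nat muln1. Qed.

Lemma cnt_le (A : pred nat) l u : cnt A l u <= u - l.
Proof. by rewrite -sum1_nat; apply: leq_sum_nat_cond => x _; case: (A x). Qed.

Lemma cnt_full (A : pred nat) l u :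
  (forall x, l <= x < u -> A x) -> cnt A l u = u - l.
Proof.
by move=> h; rewrite -sum1_nat /cnt; apply: eq_big_nat => i /h ->.
Qed.

Lemma cnt_none (A : pred nat) l u :
  (forall x, l <= x < u -> ~~ A x) -> cnt A l u = 0.
Proof.
by move=> h; rewrite /cnt big_nat big1 // => i /h /negbTE ->.
Qed.

Lemma cnt_sub (A B : pred nat) l u :
  (forall x, l <= x < u -> A x -> B x) -> cnt A l u <= cnt B l u.
Proof.
move=> h; apply: leq_sum_nat_cond => x /h; case: (A x) => //= ->//.
Qed.

Lemma eq_cnt (A B : pred nat) l u :
  (forall x, l <= x < u -> A x = B x) -> cnt A l u = cnt B l u.
Proof. by move=> h; rewrite /cnt; apply: eq_big_nat => i /h ->. Qed.

Lemma cnt_widen (A : pred nat) l u l' u' :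
  l' <= l -> u <= u' -> cnt A l u <= cnt A l' u'.
Proof.
move=> h1 h2; have [h|h] := leqP l u; last by rewrite cnt_geq //; lia.
rewrite (@cnt_cat A l' l u') //; last lia.
by rewrite (@cnt_cat A l u u') //; lia.
Qed.

Lemma cnt_shift (A : pred nat) c l u :
  cnt A (l + c) (u + c) = cnt (fun x => A (x + c)) l u.
Proof. by rewrite /cnt big_addn addnK. Qed.

Lemma cnt_shift_le (A B : pred nat) c l u :
  (forall x, l <= x < u -> A x -> B (x + c)) ->
  cnt A l u <= cnt B (l + c) (u + c).
Proof. by move=> h; rewrite cnt_shift; apply: cnt_sub. Qed.

Lemma cntE (A : pred nat) n : cnt A 0 n = size (filter A (iota 0 n)).
Proof.
by rewrite /cnt /index_iota subn0 size_filter -sum1_count [RHS]big_mkcond.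
Qed.

Lemma cnt_inj (A B : pred nat) (f : nat -> nat) n n' :
  (forall x, x < n -> A x -> f x < n' /\ B (f x)) ->
  (forall x y, x < n -> y < n -> A x -> A y -> f x = f y -> x = y) ->
  cnt A 0 n <= cnt B 0 n'.
Proof.
move=> h hi; rewrite !cntE -(size_map f); apply: uniq_leq_size.
  rewrite map_inj_in_uniq ?filter_uniq ?iota_uniq // => x y.
  by rewrite !mem_filter !mem_iota => /andP[? ?] /andP[? ?]; apply: hi.
move=> _ /mapP[x + ->]; rewrite !mem_filter !mem_iota => /andP[Ax /andP[_ ltx]].
by have [-> ->] := h _ ltx Ax.
Qed.

Lemma cnt_bound (A : pred nat) m n :
  (forall x, A x -> x < m) -> m <= n -> cnt A 0 n = cnt A 0 m.
Proof.
move=> h le; rewrite (@cnt_cat _ 0 m) // [X in _ + X]cnt_none ?addn0 // => x /andP[h1 _].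
by apply/negP => /h; lia.
Qed.

(* [x] and [u - x] cannot both be summands of the missing element [u]. *)
Lemma addp_pigeon (A B : pred nat) u lo hi :
  ~~ addp A B u -> lo <= hi -> hi <= u.+1 ->
  cnt A lo hi + cnt B (u.+1 - hi) (u.+1 - lo) <= hi - lo.
Proof.
move=> hole le1 le2.
have -> : cnt B (u.+1 - hi) (u.+1 - lo) = cnt (fun x => B (u - x)) lo hi.
  rewrite /cnt -[X in \sum_(X <= i < _) B i]add0n big_addn.
  rewrite (_ : u.+1 - lo - (u.+1 - hi) = hi - lo); last lia.
  rewrite [RHS]big_nat_rev /= -[X in \sum_(X <= i < hi) _]add0n big_addn.
  by apply: eq_big_nat => i hi'; congr (nat_of_bool (B _)); lia.
rewrite -sum1_nat /cnt -big_split /=; apply: leq_sum_nat_cond => x hx.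
have : ~~ (A x && B (u - x)).
  apply: contra hole => /andP[Ax Bx].
  have -> : u = x + (u - x) by lia.
  exact: addpI.
by case: (A x); case: (B _).
Qed.

(** With [x] the largest element of [A] and [y] the least of [B], the translates [A + y] and [x + B]
    meet only in [x + y]. *)
Lemma cnt_addp (A B : pred nat) m n a0 b0 :
  A a0 -> B b0 -> (forall x, A x -> x <= m) -> (forall x, B x -> x <= n) ->
  cnt A 0 m.+1 + cnt B 0 n.+1 <= (cnt (addp A B) 0 (m + n).+1).+1.
Proof.
move=> Aa Bb bA bB.
have [x Ax mx] := ex_maxnP (ex_intro _ a0 Aa) bA.
have [y By my] := ex_minnP (ex_intro _ b0 Bb).
have lex := bA _ Ax.
have ley := bB _ By.
rewrite (@cnt_cat (addp A B) 0 (x + y).+1) //; last lia.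
have h1 : cnt A 0 m.+1 <= cnt (addp A B) 0 (x + y).+1.
  rewrite (@cnt_bound A x.+1); [|by move=> z /mx|lia].
  apply: leq_trans (_ : cnt (addp A B) (0 + y) (x.+1 + y) <= _); last first.
    by apply: cnt_widen; lia.
  by apply: cnt_shift_le => z _ Az; apply: addpI.
have h2 : cnt B 0 n.+1 <= (cnt (addp A B) (x + y).+1 (m + n).+1).+1.
  rewrite (@cnt_cat B 0 y.+1 n.+1); [|lia|by have := bB _ By; lia].
  have -> : cnt B 0 y.+1 = 1.
    rewrite cntS // By cnt_none // => z hz; apply/negP => /my; lia.
  rewrite add1n ltnS.
  apply: leq_trans (_ : cnt (addp A B) (y.+1 + x) (n.+1 + x) <= _); last first.
    by apply: cnt_widen; lia.
  by apply: cnt_shift_le => z _ Bz; rewrite addnC; apply: addpI.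
lia.
Qed.

(** * Sumsets of two dense sets *)

Section DenseSumset.

Variables (A B : pred nat) (m n : nat).
Hypotheses (lenm : n <= m) (A0 : A 0) (Am : A m) (B0 : B 0) (Bn : B n).

Local Notation S := (addp A B).
Local Notation a := (cnt A 0 m.+1).
Local Notation b := (cnt B 0 n.+1).

Hypothesis dense : m + 3 <= a + b.

(** The excess [F y - y] detects holes of [S]: a missing [y] makes it small just after [y], a
    missing [v + m] makes it large at [v]. *)
Let F y := cnt A 0 y + cnt B 0 y.

Lemma low_hole y : ~~ S y -> F y.+1 <= y.+1.
Proof.
move=> hy; have := @addp_pigeon A B y 0 y.+1 hy (leq0n _) (leqnn _).
by rewrite subnn subn0.
Qed.

(** If [y] were missing, the [n + 1] pairs [(y - i, i)] would hold at most [n + 1] elements; [A] has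
    at most [m - n] others, against [dense]. *)
Lemma mid_full y : n <= y <= m -> S y.
Proof.
move=> /andP[h1 h2]; apply/negPn/negP => hy.
have := @addp_pigeon A B y (y - n) y.+1 hy.
rewrite subnn (_ : y.+1 - (y - n) = n.+1); last lia.
move=> /(_ ltac:(lia) (leqnn _)).
have := @cnt_cat A 0 (y - n) m.+1 (leq0n _) ltac:(lia).
have := @cnt_cat A (y - n) y.+1 m.+1 ltac:(lia) ltac:(lia).
have := cnt_le A 0 (y - n); have := cnt_le A y.+1 m.+1; lia.
Qed.

Lemma high_hole_cnt u : m <= u -> u <= m + n -> ~~ S u ->
  cnt A (u - n) m.+1 + cnt B (u - m) n.+1 <= (m + n).+1 - u.
Proof.
move=> h1 h2 hu; have := @addp_pigeon A B u (u - n) m.+1 hu.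
have -> : u.+1 - (u - n) = n.+1 by lia.
rewrite subSS => /(_ ltac:(lia) ltac:(lia)); lia.
Qed.

Lemma high_hole v : v <= n -> ~~ S (v + m) -> v + (a + b - m) <= F v + 1.
Proof.
move=> h1 hv.
have h2 : v + m <= m + n by lia.
have := high_hole_cnt (leq_addl v m) h2 hv.
rewrite (_ : v + m - m = v); last lia.
have := @cnt_cat A 0 v m.+1 (leq0n _) ltac:(lia).
have := @cnt_cat A v (v + m - n) m.+1 ltac:(lia) ltac:(lia).
have := @cnt_cat B 0 v n.+1 (leq0n _) ltac:(lia).
have := cnt_le A v (v + m - n); rewrite /F; lia.
Qed.

Lemma F_step y : F y.+1 = F y + A y + B y.
Proof. by rewrite /F !cntS //; lia. Qed.

(** Two holes would give [F y.+1 <= y.+1] and, by [dense], [F y >= y + 2], although [F] never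
    decreases. *)
Lemma residue_full y : y < n -> S y || S (y + m).
Proof.
move=> lty; apply/negPn; rewrite negb_or; apply/negP => /andP[h1 h2].
have := low_hole h1; have := high_hole (ltnW lty) h2; rewrite F_step.
have -> : A y = false.
  by apply: contraNF h1 => Ay; rewrite -[y]addn0; apply: addpI.
have -> : B y = false.
  by apply: contraNF h1 => By; rewrite -[y]add0n; apply: addpI.
lia.
Qed.

(* Each residue modulo [m] is hit by [S]; those in [B] or [X] are hit twice. *)
Lemma dense_addp_gain (X : pred nat) :
  (forall y, y < n -> X y -> [/\ ~~ B y, S y & S (y + m)]) ->
  m + b + cnt X 0 n <= cnt S 0 (m + n).+1.
Proof.
move=> hX.
have full : cnt S n m = m - n by apply: cnt_full => x hx; apply: mid_full; lia.
have -> : cnt S 0 (m + n).+1 = cnt S 0 n + (m - n) + cnt S m (m + n) + 1.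
  rewrite (@cnt_cat S 0 m) //; last lia.
  rewrite (@cnt_cat S 0 n m) // full (@cntS S m (m + n)) ?leq_addr //.
  by rewrite (addpI Am Bn) addnA.
rewrite (cntS _ (leq0n n)) Bn.
have -> : cnt S m (m + n) = cnt (fun x => S (x + m)) 0 n.
  by rewrite -cnt_shift add0n addnC.
suff : cnt B 0 n + cnt X 0 n + n
  <= cnt S 0 n + cnt (fun x => S (x + m)) 0 n by lia.
rewrite /cnt -!big_split /= -[X in _ + X]subn0 -sum1_nat -big_split /=.
apply: leq_sum_nat_cond => y /andP[_ lty].
have := residue_full lty.
have : B y -> S y && S (y + m).
  move=> By; rewrite [y + m]addnC (addpI Am By) andbT.
  by rewrite -[y]add0n; apply: addpI.
have := hX _ lty; case: (X y) => [/(_ isT)[/negbTE -> -> ->] //|_].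
case: (B y) => [/(_ isT)/andP[-> ->] //|_].
by case: (S y); case: (S (y + m)).
Qed.

Lemma dense_addp_card : m + b <= cnt S 0 (m + n).+1.
Proof.
apply: leq_trans (@dense_addp_gain pred0 _) => //; exact: leq_addr.
Qed.

Hypothesis small : cnt S 0 (m + n).+1 + 4 <= a + 2 * b.

(* Between a late low hole [t] and an early high hole [v + m] the excess
   [F y - y] decreases from at least [e - 1] to at most [0], where
   [e = a + b - m]; every downward step at an intermediate height is a residue
   outside [B] hit twice by [S]. *)
Lemma holes_do_not_cross t v :
  t < n -> v <= t -> ~~ S t -> ~~ S (v + m) -> False.
Proof.
move=> ltt lev ht hv.
have Ft := low_hole ht; have Fv := high_hole (leq_trans lev (ltnW ltt)) hv.
pose e := a + b - m.
pose X := fun y => [&& v <= y, ~~ A y, ~~ B y, F y + 2 <= y + e & y + 2 <= F y.+1].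
have hX y : y < n -> X y -> [/\ ~~ B y, S y & S (y + m)].
  move=> lty /and5P[_ _ nB h1 h2]; split=> //.
    by apply/negPn/negP => /low_hole; lia.
  by apply/negPn/negP => /(high_hole (ltnW lty)); rewrite -/e; lia.
have gain := dense_addp_gain hX.
(* The excess clamped to [[1, e - 2]] starts at [e - 2], ends at 1, and drops by at most one, only
   where [X] holds. So [X] has at least [e - 3] members, too many for [small]. *)
have clamp j : e - 2 <= cnt X v (v + j) + maxn 1 (minn (F (v + j) - (v + j)) (e - 2)).
  elim: j => [|j IH]; first by rewrite addn0 cnt_geq //; lia.
  rewrite addnS cntS ?leq_addr // F_step.
  apply: leq_trans IH _; rewrite /X leq_addr /= F_step.
  by case: (A _); case: (B _) => /=; lia.
have := clamp (t.+1 - v); rewrite subnKC; last lia.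
have : cnt X v t.+1 <= cnt X 0 n by apply: cnt_widen.
lia.
Qed.

(** Take the maximal run of sums around [[n, m]]. The holes at its ends bound the elements of [A]
    and [B] at the low and the high end; as [lo <= hi - m], the others lie in windows of lengths
    [hi - n - lo] and [hi - m - lo], and the bounds add up. *)
Lemma dense_addp_interval :
  exists lo hi, (forall x, lo <= x < hi -> S x) /\ lo + (a + b) <= hi.+1.
Proof.
pose low l := (l <= n) && all S (index_iota l n).
pose high u := [&& m <= u, u <= (m + n).+1 & all S (index_iota m u)].
have exlo : exists l, low l by exists n; rewrite /low leqnn /index_iota subnn.
have [lo /andP[lelo /allP hlo] milo] := ex_minnP exlo.
have exhi : exists u, high u.
  by exists m; rewrite /high leqnn /index_iota subnn andbT /=; lia.
have bhi u : high u -> u <= (m + n).+1 by case/and3P.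
have [hi /and3P[lehi1 lehi2 /allP hhi] mahi] := ex_maxnP exhi bhi.
have full x : lo <= x < hi -> S x.
  move=> /andP[h1 h2]; case: (ltnP x n) => [ltx|gex].
    by apply: hlo; rewrite mem_index_iota h1.
  case: (leqP x m) => hx; first by apply: mid_full; lia.
  by apply: hhi; rewrite mem_index_iota h2 ltnW.
have lo_hole t : lo = t.+1 -> ~~ S t.
  move=> lot; apply/negP => St; suff /milo : low t by lia.
  rewrite /low; apply/andP; split; first lia.
  apply/allP => i; rewrite mem_index_iota => hi1.
  have [-> //|ne] := eqVneq i t.
  by apply: hlo; rewrite mem_index_iota; lia.
have hi_hole : hi <= m + n -> ~~ S hi.
  move=> le1; apply/negP => Sh; suff /mahi : high hi.+1 by lia.
  rewrite /high; apply/and3P; split; [lia|lia|].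
  apply/allP => i; rewrite mem_index_iota => hi1.
  have [-> //|ne] := eqVneq i hi.
  by apply: hhi; rewrite mem_index_iota; lia.
exists lo, hi; split=> //.
have Flo : F lo <= lo.
  case: (posnP lo) => [->|lo_gt0]; first by rewrite /F !cnt_geq.
  by rewrite -(prednK lo_gt0); apply/low_hole/lo_hole; rewrite prednK.
have Chi : cnt A (hi - n) m.+1 + cnt B (hi - m) n.+1 <= (m + n).+1 - hi.
  case: (leqP hi (m + n)) => h; first exact: high_hole_cnt (hi_hole h).
  by rewrite !cnt_geq //; lia.
have lov : lo <= hi - m.
  case: (leqP hi (m + n)) => h; last lia.
  case: (leqP lo (hi - m)) => // h2; exfalso.
  apply: (@holes_do_not_cross lo.-1 (hi - m)); [lia|lia| |].
    by apply: lo_hole; lia.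
  by rewrite subnK //; exact: hi_hole.
have := @cnt_cat A 0 lo m.+1 (leq0n _) ltac:(lia).
have := @cnt_cat A lo (hi - n) m.+1 ltac:(lia) ltac:(lia).
have := @cnt_cat B 0 lo n.+1 (leq0n _) ltac:(lia).
have := @cnt_cat B lo (hi - m) n.+1 ltac:(lia) ltac:(lia).
have := cnt_le A lo (hi - n); have := cnt_le B lo (hi - m).
move: Flo; rewrite /F; lia.
Qed.

End DenseSumset.

(** * Freiman's theorem for sets of integers *)

Lemma leq_cnt3 (P Q T U : pred nat) u :
  (forall x, x < u -> P x + Q x + T x <= U x) ->
  cnt P 0 u + cnt Q 0 u + cnt T 0 u <= cnt U 0 u.
Proof.
by move=> h; rewrite /cnt -!big_split; apply: leq_sum_nat_cond => x /andP[_ /h].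
Qed.

(** * Induction step for sparse sets: cutting [A] at a gap [y] into [B] below and [R] above *)

Section SparseStep.

Variables (A : pred nat) (m y n : nat).
Hypotheses (A0 : A 0) (Am : A m) (bA : forall x, A x -> x <= m).
Hypothesis gcdA : forall d, (forall x, A x -> d %| x) -> d = 1.
Hypotheses (nAy : ~~ A y) (ltym : y < m).

Let B : pred nat := fun x => A x && (x < y).
Let R : pred nat := fun x => A x && (y < x).

Hypotheses (Bn : B n) (bB : forall x, B x -> x <= n).

Local Notation S := (addp A A).
Local Notation b := (cnt B 0 n.+1).
Local Notation j := (cnt R 0 m.+1).

Let ltny : n < y. Proof. by case/andP: Bn. Qed.

Let SB_sub x : addp B B x -> S x /\ x <= n + n.
Proof.
case/addpP=> x1 [x2 [B1 B2 <-]]; have := bB B1; have := bB B2.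
by case/andP: B1 => A1 _; case/andP: B2 => A2 _; split; [apply: addpI|lia].
Qed.

(** The translate [n + R], whose elements exceed [n + n] and so avoid [B + B]. *)
Let T : pred nat := fun x => (n <= x) && R (x - n).

Let T_sub x : T x -> S x /\ n + n < x.
Proof.
case/andP=> lenx /andP[Ax lty]; have An : A n by case/andP: Bn.
by split; [rewrite -(subnK lenx); apply: addpI|have := ltny; lia].
Qed.

Let T_cnt : j <= cnt T 0 (m + n).+1.
Proof.
apply: leq_trans (_ : cnt T (0 + n) (m.+1 + n) <= _); last by apply: cnt_widen; clear; lia.
by apply: cnt_shift_le => x _ Rx; rewrite /T leq_addl addnK.
Qed.

Let SB_cnt : cnt (addp B B) 0 (n + n).+1 <= cnt (addp B B) 0 (m + n).+1.
Proof. by apply: cnt_widen; have := bA (proj1 (andP Bn)); lia. Qed.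

(** Some element of [R] is not divisible by [d]. The sums [B + B], the multiples of [d] in [R]
    shifted by [n], and the non-multiples plus [B] are disjoint; the first and last are bounded by
    [cnt_addp]. *)
Lemma sparse_step_common_divisor d : (forall x, B x -> d %| x) -> d <> 1 ->
  3 * b + j <= cnt S 0 (m + n).+1 + 2.
Proof.
move=> dB d1.
have [r Rr ndr] : exists2 r, R r & ~~ (d %| r).
  case: (boolP (has (fun x => R x && ~~ (d %| x)) (iota 0 m.+1))).
    by case/hasP=> r _ /andP[]; exists r.
  move=> /hasPn h; case: d1; apply: gcdA => x Ax.
  case: (ltngtP x y) => hx; last by move: nAy; rewrite -hx Ax.
    by apply: dB; rewrite /B Ax.
  have /h : x \in iota 0 m.+1 by rewrite mem_iota; have := bA Ax; lia.
  by rewrite /R Ax hx negbK.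
pose R0 : pred nat := fun x => R x && (d %| x).
pose R1 : pred nat := fun x => R x && ~~ (d %| x).
pose T1 : pred nat := fun x => T x && (d %| (x - n)).
have cR : j = cnt R0 0 m.+1 + cnt R1 0 m.+1.
  rewrite /cnt -big_split; apply: eq_bigr => x _; rewrite /R0 /R1 /=.
  by case: (R x); case: (d %| x).
have cT : cnt R0 0 m.+1 <= cnt T1 0 (m + n).+1.
  apply: leq_trans (_ : cnt T1 (0 + n) (m.+1 + n) <= _); last by apply: cnt_widen; clear; lia.
  by apply: cnt_shift_le => x _; rewrite /R0 /T1 /T leq_addl addnK.
have bR1 x : R1 x -> x <= m by case/andP => /andP[/bA].
have c1 := cnt_addp Bn Bn bB bB.
have c2 := @cnt_addp R1 B m n r n (introT andP (conj Rr ndr)) Bn bR1 bB.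
suff : cnt (addp B B) 0 (m + n).+1 + cnt T1 0 (m + n).+1
   + cnt (addp R1 B) 0 (m + n).+1 <= cnt S 0 (m + n).+1.
  have := SB_cnt; lia.
apply: leq_cnt3 => x _.
have h1 : addp B B x -> [/\ S x, x <= n + n & d %| x].
  move=> sx; have [? ?] := SB_sub sx; split=> //.
  by case/addpP: sx => x1 [x2 [B1 B2 <-]]; rewrite dvdn_add ?dB.
have h2 : T1 x -> [/\ S x, n + n < x & d %| x].
  case/andP=> tx dx; have [? ?] := T_sub tx; split=> //.
  case/andP: tx => lenx _.
  by rewrite -(subnK lenx) dvdn_add // dB.
have h3 : addp R1 B x -> S x && ~~ (d %| x).
  case/addpP=> x1 [x2 [/andP[/andP[A1 _] nd] B2 <-]].
  rewrite addpI //=; last by case/andP: B2.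
  by rewrite (dvdn_addl _ (dB _ B2)).
case: (addp B B x) h1 => [/(_ isT)[-> le dx]|_].
  case: (T1 x) h2 => [/(_ isT)[_ lt _]|_]; first lia.
  by case: (addp R1 B x) h3 => // /(_ isT)/andP[_]; rewrite dx.
case: (T1 x) h2 => [/(_ isT)[-> lt dx]|_].
  by case: (addp R1 B x) h3 => // /(_ isT)/andP[_]; rewrite dx.
by case: (addp R1 B x) h3 => // /(_ isT)/andP[-> _].
Qed.

(* If [2B] and [n + R] already exhausted the sums, [R] would continue as an
   arithmetic progression the two largest elements of [B]; then [m + c], with
   [c] the largest element of [A] outside that residue class, is a new sum. *)
Lemma sparse_step_extra_sum : 0 < n -> 3 * b <= cnt (addp B B) 0 (n + n).+1 + 3 ->
  3 * b + j <= cnt S 0 (m + n).+1 + 2.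
Proof.
move=> n_gt0 hSB.
case: (boolP (has (fun z => [&& S z, ~~ addp B B z & ~~ T z]) (iota 0 (m + n).+1))).
  case/hasP => z; rewrite mem_iota => hz /and3P[Sz nBz nTz].
  have cz : cnt (pred1 z) 0 (m + n).+1 = 1.
    rewrite (@cnt_cat _ 0 z) ?(@cnt_recl _ z) //; try lia.
    rewrite /= eqxx !cnt_none // => x hx; rewrite /= neq_ltn; lia.
  suff : cnt (addp B B) 0 (m + n).+1 + cnt T 0 (m + n).+1
     + cnt (pred1 z) 0 (m + n).+1 <= cnt S 0 (m + n).+1.
    by have := SB_cnt; have := T_cnt; lia.
  apply: leq_cnt3 => x _ /=.
  have [->|_] := eqVneq x z; first by rewrite (negbTE nBz) (negbTE nTz) Sz.
  case: (addp B B x) (@SB_sub x) => [/(_ isT)[-> le]|_].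
    by case: (T x) (@T_sub x) => // /(_ isT)[_]; lia.
  by case: (T x) (@T_sub x) => // /(_ isT)[->].
move=> /hasPn nz; exfalso; clear hSB.
have cover z : z <= m + n -> S z -> addp B B z \/ T z.
  move=> lez Sz; have /nz : z \in iota 0 (m + n).+1 by rewrite mem_iota; lia.
  by rewrite Sz /= negb_and !negbK => /orP.
have B0 : B 0 by rewrite /B A0; have := ltny; lia.
have An : A n by case/andP: Bn.
have [n2 /andP[Bn2 ltn2] mn2] : exists2 n2, B n2 && (n2 < n) &
    forall x, B x && (x < n) -> x <= n2.
  have bd x : B x && (x < n) -> x <= n by case/andP=> /bB.
  have ex : exists x, B x && (x < n) by exists 0; rewrite B0.
  by have [n2 h1 h2] := ex_maxnP ex bd; exists n2.
have nB2 x : B x -> n2 < x -> x = n.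
  move=> Bx lt; have le := bB Bx; apply/eqP; rewrite eqn_leq le /=.
  by rewrite leqNgt; apply/negP => h; have := mn2 x; rewrite Bx h; lia.
have ny := ltny; have sub2 x1 x2 r : x1 <= n -> x2 <= n -> n < r ->
    x1 + x2 = r + n2 -> n2 < x1 /\ n2 < x2 by clear; lia.
(* If [r + n2] is in [B + B], both summands exceed [n2], hence equal [n]; otherwise it is in
   [n + R], and [r] has a predecessor in [R]. *)
have stepR r : R r -> r = n + (n - n2) \/ R (r - (n - n2)) /\ n - n2 <= r.
  move=> /andP[Ar ltyr].
  have An2 : A n2 by case/andP: Bn2.
  have lerm := bA Ar; have ltnr := ltn_trans ny ltyr.
  have lern2 : r + n2 <= m + n by apply: leq_add => //; apply: ltnW.
  case: (cover (r + n2) lern2 (addpI Ar An2)) => [|/andP[_]].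
    case/addpP=> x1 [x2 [B1 B2 e]]; left.
    have [g1 g2] := sub2 _ _ _ (bB B1) (bB B2) ltnr e.
    by move: e; rewrite (nB2 _ B1 g1) (nB2 _ B2 g2); clear -ltn2; lia.
  have -> : r + n2 - n = r - (n - n2) by clear -ltn2 ltnr; lia.
  by move=> h2; right; split=> //; clear -ltn2 ltnr; lia.
set c1 := n - n2 in stepR *.
have c1_gt0 : 0 < c1 by rewrite /c1 subn_gt0.
have structR r : R r -> r = n %[mod c1] /\ n + c1 <= r /\ R (n + c1).
  elim/ltn_ind: r => r IH Rr; case: (stepR _ Rr) => [e|[Rr' le]].
    by subst r; rewrite modnDr.
  have [|e1 [e2 e3]] := IH _ _ Rr'; first by clear -c1_gt0 le; lia.
  split; last by split=> //; clear -e2; lia.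
  by rewrite -e1 -{1}(subnK le) modnDr.
have Rm : R m by rewrite /R Am.
have [mm [lem Rn]] := structR _ Rm.
(* The gap [y] lies strictly between [n] and [n + c1]. *)
have c1_gt1 : 1 < c1 by case/andP: Rn => _; clear -ny; lia.
have n2m : n2 = n %[mod c1].
  by rewrite -[in RHS](subnK (ltnW ltn2)) -/c1 modnDl.
have [c Ac /andP[nc mc]] : exists2 c, A c & (c != m %[mod c1]) &&
    all (fun x => A x ==> (x != m %[mod c1]) ==> (x <= c)) (iota 0 m.+1).
  have bd x : A x && (x != m %[mod c1]) -> x <= m by case/andP=> /bA.
  case: (boolP (has (fun x => A x && (x != m %[mod c1])) (iota 0 m.+1))).
    case/hasP => x0 _ hx0.
    have [c /andP[Ac nc] mc] := ex_maxnP (ex_intro _ x0 hx0) bd.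
    exists c => //; rewrite nc; apply/allP => x _.
    by apply/implyP => Ax; apply/implyP => nx; apply: mc; rewrite Ax nx.
  move=> /hasPn all_m; have : c1 = 1; last by clear -c1_gt1; lia.
  apply: gcdA => x Ax.
  have congm z : A z -> z = m %[mod c1].
    move=> Az; have /all_m : z \in iota 0 m.+1 by rewrite mem_iota; apply: (bA Az).
    by rewrite Az negbK => /eqP.
  by apply/dvdnP; exists (x %/ c1); rewrite {1}(divn_eq x c1) congm // -(congm 0) // mod0n addn0.
have maxc x : A x -> c < x -> x = m %[mod c1].
  move=> Ax lt; apply/eqP; apply/negPn/negP => nx.
  have /(allP mc) : x \in iota 0 m.+1 by rewrite mem_iota; apply: (bA Ax).
  by rewrite Ax nx /= leqNgt lt.
have lec : c <= n.
  case: (ltngtP c y) => hc; first by apply: bB; rewrite /B Ac.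
    have Rc : R c by rewrite /R Ac.
    by move: nc; rewrite (structR _ Rc).1 mm eqxx.
  by move: nAy; rewrite -hc Ac.
have ltnm := ltn_trans ny ltym.
(* In [B + B] both summands would exceed [c], as they are below [m]; then, as in [n + R], the sum
   would be [2 m] modulo [c1], forcing [c] into the class of [m]. *)
case: (cover (m + c) (leq_add (leqnn m) lec) (addpI Am Ac)).
  case/addpP=> x1 [x2 [B1 B2 e]].
  have l1 := bB B1; have l2 := bB B2.
  have g1 : c < x1 by clear -l1 l2 e ltnm; lia.
  have g2 : c < x2 by clear -l1 l2 e ltnm; lia.
  have e1 := maxc x1 (proj1 (andP B1)) g1.
  have e2 := maxc x2 (proj1 (andP B2)) g2.
  move/negP: nc; apply; rewrite -(eqn_modDl m) -e.
  by rewrite -modnDm e1 e2 modnDm.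
case/andP => _ /structR [e _]; move/negP: nc; apply.
rewrite -(eqn_modDl m); have -> : m + c = (m + c - n) + n by clear -ltnm; lia.
by rewrite -modnDm e -mm modnDm.
Qed.

(** With [r] the least element of [R], the sums up to [r + n] include the interval, the part of [B]
    below [lo], and the part of [r + B] from [hi] on. Elements of [B] lost between these parts
    number at most [hi - r - lo], which [r >= 2 * b] compensates. Beyond [r + n] come the remaining
    elements of [n + R]. *)
Lemma sparse_step_dense lo hi :
  (forall x, lo <= x < hi -> addp B B x) -> lo + 2 * b <= hi.+1 ->
  2 * b <= y.+1 -> 3 * b + j <= cnt S 0 (m + n).+1 + 2.
Proof.
move=> full lohi by2.
have bR x : R x -> x <= m by case/andP=> /bA.
have Rm : R m by rewrite /R Am.
have [r Rr minr] := ex_minnP (ex_intro _ m Rm).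
have ny := ltny; have ler := bR _ Rr; have ltyr : y < r by case/andP: Rr.
have An : A n by case/andP: Bn.
have B0 : B 0 by rewrite /B A0; lia.
have b1 : 0 < b by rewrite cnt_recl // B0.
rewrite (@cnt_cat S 0 (r + n).+1) //; last lia.
have c1 : cnt R 0 m.+1 <= (cnt S (r + n).+1 (m + n).+1).+1.
  rewrite (@cnt_cat R 0 r.+1) //.
  rewrite cntS // cnt_none => [|x hx]; last by apply/negP => /minr; lia.
  rewrite Rr add0n add1n ltnS.
  apply: leq_trans (_ : cnt S (r.+1 + n) (m.+1 + n) <= _); last by apply: cnt_widen; clear; lia.
  by apply: cnt_shift_le => x _ /andP[Ax _]; apply: addpI.
suff : 3 * b <= (cnt S 0 (r + n).+1).+1 by clear -c1; lia.
have hin : hi <= (n + n).+1.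
  rewrite leqNgt; apply/negP => h.
  have g : lo <= hi.-1 < hi by clear -h lohi b1; lia.
  by have [_] := SB_sub (full hi.-1 g); clear -h; lia.
have lohi2 : lo <= hi by clear -lohi b1; lia.
have hirn : hi <= (r + n).+1 by clear -hin ny ltyr; lia.
rewrite (cnt_cat S (leq0n lo) (leq_trans lohi2 hirn)) (cnt_cat S lohi2 hirn).
rewrite (@cnt_full S lo hi); last by move=> x /full /SB_sub[].
have c2 : cnt B 0 lo <= cnt S 0 lo.
  by apply: cnt_sub => x _ /andP[Ax _]; rewrite -[x]add0n; apply: addpI.
have c3 : cnt B (hi - r) n.+1 <= cnt S hi (r + n).+1.
  apply: leq_trans (_ : cnt S (hi - r + r) (n.+1 + r) <= _).
    apply: cnt_shift_le => x _ /andP[Ax _].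
    by apply: addpI => //; case/andP: Rr.
  by apply: cnt_widen; clear; lia.
have c4 : b <= cnt B 0 lo + (hi - r - lo) + cnt B (hi - r) n.+1.
  have g : hi - r <= n.+1 by clear -hirn; lia.
  case: (leqP lo (hi - r)) => h.
    rewrite (cnt_cat B (leq0n lo) (leq_trans h g)) (cnt_cat B h g).
    by have := cnt_le B lo (hi - r); clear; lia.
  rewrite (cnt_cat B (leq0n _) g).
  by have := cnt_widen B (leq0n 0) (ltnW h); clear; lia.
by clear -c2 c3 c4 lohi lohi2 b1 by2 ltyr; lia.
Qed.

End SparseStep.

(** The sparse half of Freiman's theorem, by strong induction on the diameter [m]. *)
Lemma freiman_sparse (m : nat) (A : pred nat) :
  A 0 -> A m -> (forall x, A x -> x <= m) ->
  (forall d, (forall x, A x -> d %| x) -> d = 1) ->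
  2 * cnt A 0 m.+1 <= m + 2 ->
  3 * cnt A 0 m.+1 <= cnt (addp A A) 0 (m + m).+1 + 3.
Proof.
elim/ltn_ind: m A => m IH A A0 Am bA gcdA sparse.
have m_gt0 : 0 < m.
  rewrite lt0n; apply/eqP => m0; have : 0 = 1; last by [].
  by apply: gcdA => x /bA; rewrite m0 leqn0 dvd0n.
(* Above the largest [y] with at most half of [y, m] in [A], every suffix of [A]
   is dense, so [2A] contains everything beyond [m + y]; induct on [A] below [y]. *)
pose P := fun z => (z <= m) && (2 * cnt A z m.+1 <= m.+1 - z).
have ex : exists z, P z.
  exists 1; rewrite /P m_gt0; have := cnt_recl A (ltn0Sn m); rewrite A0; lia.
have bP z : P z -> z <= m by case/andP.
have [y /andP[leym hy] maxy] := ex_maxnP ex bP.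
have maxy' z : y < z -> z <= m -> m.+1 - z < 2 * cnt A z m.+1.
  move=> h1 h2; rewrite ltnNge; apply/negP => h3.
  by have := maxy z; rewrite /P h2 h3; lia.
have ltym : y < m.
  rewrite ltn_neqAle leym andbT; apply/eqP => e; move: hy; rewrite e.
  by rewrite cnt_recl // Am; lia.
have cy := @cnt_recl A y m.+1 (leqW ltym).
have my := maxy' y.+1 (leqnn _) ltym.
have nAy : ~~ A y by apply/negP => Ay; move: cy; rewrite Ay; lia.
rewrite (negbTE nAy) add0n in cy.
have y_gt0 : 0 < y by case: posnP nAy => // ->; rewrite A0.
pose B : pred nat := fun x => A x && (x < y).
have B0 : B 0 by rewrite /B A0.
have bBy x : B x -> x <= y by case/andP=> _ /ltnW.
have [n Bn bB] := ex_maxnP (ex_intro _ 0 B0) bBy.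
have ltny : n < y by case/andP: Bn.
have cB : cnt B 0 n.+1 = cnt A 0 y.
  have bB' x : B x -> x < n.+1 by move/bB.
  rewrite -(cnt_bound bB' ltny).
  by apply: eq_cnt => x /andP[_ h]; rewrite /B h andbT.
have cR : cnt (fun x => A x && (y < x)) 0 m.+1 = cnt A y.+1 m.+1.
  rewrite (@cnt_cat _ 0 y.+1) // cnt_none => [|x h]; last by rewrite negb_and; lia.
  by apply: eq_cnt => x /andP[h _]; rewrite h andbT.
have ck : cnt A 0 m.+1 = cnt B 0 n.+1 + cnt A y.+1 m.+1.
  by rewrite cB -cy -cnt_cat //; lia.
suff : 3 * cnt B 0 n.+1 + cnt (fun x => A x && (y < x)) 0 m.+1
     <= cnt (addp A A) 0 (m + n).+1 + 2.
  rewrite cR ck => main.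
  (* A sum [w] beyond [m + y] pairs off the suffix [[w - m, m]] with itself, and that suffix is more
     than half full. *)
  have full : cnt (addp A A) (m + y).+1 (m + m).+1 = m - y.
    rewrite cnt_full => [|w hw]; first lia.
    apply/negPn/negP => hole.
    have := @addp_pigeon A A w (w - m) m.+1 hole.
    have -> : w.+1 - (w - m) = m.+1 by lia.
    rewrite subSS => /(_ ltac:(lia) ltac:(lia)).
    have := maxy' (w - m) ltac:(lia) ltac:(lia); lia.
  rewrite (@cnt_cat (addp A A) 0 (m + y).+1) //; last lia.
  rewrite full.
  have : cnt (addp A A) 0 (m + n).+1 <= cnt (addp A A) 0 (m + y).+1.
    by apply: cnt_widen; lia.
  lia.
(* Finitely many [d] decide whether [B] has gcd 1: for [n > 0] a common divisor divides [n], and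
   [d = 0] detects [B = {0}]. *)
case: (boolP (all (fun d => all (fun x => B x ==> (d %| x)) (iota 0 n.+1) ==> (d == 1))
          (iota 0 n.+2))) => [/allP gB|]; last first.
  case/allPn => d _; rewrite negb_imply => /andP[/allP dB /eqP d1].
  apply: (sparse_step_common_divisor A0 Am bA gcdA nAy ltym Bn bB _ d1) => x Bx.
  have : x \in iota 0 n.+1 by rewrite mem_iota; have := bB _ Bx; lia.
  by move/dB/implyP; apply.
have gcdB' d : d <= n.+1 -> (forall x, B x -> d %| x) -> d = 1.
  move=> led dB; apply/eqP.
  have /gB/implyP : d \in iota 0 n.+2 by rewrite mem_iota.
  by apply; apply/allP => x _; apply/implyP => /dB.
have n_gt0 : 0 < n.
  rewrite lt0n; apply/eqP => n0; have : 0 = 1; last by [].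
  by apply: gcdB' => // x /bB; rewrite n0 leqn0 dvd0n.
have gcdB d : (forall x, B x -> d %| x) -> d = 1.
  by move=> dB; apply: gcdB' => //; apply: leqW; apply: dvdn_leq => //; apply: dB.
case: (leqP (3 * cnt B 0 n.+1) (cnt (addp B B) 0 (n + n).+1 + 3)) => hSB.
  exact: (sparse_step_extra_sum A0 Am bA gcdA nAy ltym Bn bB).
(* Otherwise the induction hypothesis for [B] would contradict the failure of
   [3 |B| <= |2B| + 3]. *)
have dense : n + 3 <= cnt B 0 n.+1 + cnt B 0 n.+1.
  rewrite leqNgt; apply/negP => h.
  have := IH n ltac:(lia) B B0 Bn bB gcdB; lia.
have small : cnt (addp B B) 0 (n + n).+1 + 4 <= cnt B 0 n.+1 + 2 * cnt B 0 n.+1.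
  by clear -hSB; lia.
have [lo [hi [full lohi]]] :=
  dense_addp_interval (leqnn n) B0 Bn B0 Bn dense small.
have lohi' : lo + 2 * cnt B 0 n.+1 <= hi.+1 by clear -lohi; lia.
apply: (sparse_step_dense A0 Am bA nAy ltym Bn bB full lohi').
by clear -ck cy my hy sparse leym; rewrite -/B; lia.
Qed.

(** Freiman's 3k - 4 theorem. Once the least element is moved to 0 and the gcd [g] divided out, the
    sparse case is excluded by the size of the sumset, and the dense case yields both
    progressions. *)
Lemma three_k_minus_four (A : pred nat) (M : nat) :
  (forall x, A x -> x <= M) ->
  cnt (addp A A) 0 (M + M).+1 + 4 <= 3 * cnt A 0 M.+1 ->
  exists c g m lo hi,
    [/\ 0 < g, 0 < m, A (c + g * m) & forall x, A x -> exists2 i, i <= m & x = c + g * i] /\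
    [/\ m + cnt A 0 M.+1 <= cnt (addp A A) 0 (M + M).+1,
        forall i, lo <= i < hi -> addp A A (c + c + g * i) &
        lo + 2 * cnt A 0 M.+1 <= hi.+1].
Proof.
move=> bA small; set k := cnt A 0 M.+1 in small *.
have [a Aa] : exists a, A a.
  case: (boolP (has A (iota 0 M.+1))) => [/hasP[a _ Aa]|/hasPn h]; first by exists a.
  have : k = 0 by apply: cnt_none => x hx; apply: h; rewrite mem_iota; lia.
  lia.
have [c Ac minc] := ex_minnP (ex_intro _ a Aa).
have [e Ae maxe] := ex_maxnP (ex_intro _ a Aa) bA.
pose g := \big[gcdn/0]_(i < M.+1 | A i) (i - c).
have gP d : reflect (forall x, A x -> d %| x - c) (d %| g).
  apply: (iffP (dvdn_biggcdP _ _ _)) => h x Ax; last exact: h.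
  have ltx : x < M.+1 by rewrite ltnS; apply: bA.
  exact: (h (Ordinal ltx)).
have gd x : A x -> x = c + g * ((x - c) %/ g).
  move=> Ax; have /gP/(_ x Ax) := dvdnn g.
  by rewrite mulnC => /divnK ->; rewrite subnKC //; apply: minc.
(* The gcd vanishes only for a singleton, which is too small for [small]. *)
have g_gt0 : 0 < g.
  rewrite lt0n; apply/eqP => g0.
  have : k <= cnt (pred1 c) 0 M.+1.
    by apply: cnt_sub => x _ /gd; rewrite g0 mul0n addn0 => ->; rewrite /= eqxx.
  have lec := bA _ Ac.
  rewrite (@cnt_cat _ 0 c) ?(@cnt_recl _ c) //; try lia.
  rewrite /= eqxx !cnt_none => [|x hx|x hx]; try (by rewrite /= neq_ltn; lia).
  lia.
pose A' : pred nat := fun i => A (c + g * i).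
pose m := (e - c) %/ g.
have A'0 : A' 0 by rewrite /A' muln0 addn0.
have A'm : A' m by rewrite /A' -gd.
have cov x : A x -> exists2 i, i <= m & x = c + g * i.
  move=> Ax; exists ((x - c) %/ g); last exact: gd.
  by apply: leq_div2r; apply: leq_sub2r; apply: maxe.
have bA' i : A' i -> i <= m.
  case/cov=> i' lei /eqP; rewrite eqn_add2l eqn_pmul2l // => /eqP ->//.
have ceM : c + g * m <= M by rewrite -gd //; apply: bA.
have k'k : cnt A' 0 m.+1 = k.
  apply/eqP; rewrite eqn_leq; apply/andP; split.
    apply: (@cnt_inj _ _ (fun i => c + g * i)) => [i lei A'i|i1 i2 _ _ _ _ /eqP].
      by split=> //; rewrite ltnS; apply: bA.
    by rewrite eqn_add2l eqn_pmul2l // => /eqP.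
  apply: (@cnt_inj _ _ (fun x => (x - c) %/ g)) => [x lex Ax|x1 x2 _ _ A1 A2 eqx].
    have [i lei e1] := cov _ Ax; rewrite e1 addKn mulKn // ltnS; split=> //.
    by rewrite /A' -e1.
  by rewrite (gd _ A1) (gd _ A2) eqx.
have sA' i : addp A' A' i -> addp A A (c + c + g * i).
  case/addpP=> i1 [i2 [h1 h2 <-]].
  have -> : c + c + g * (i1 + i2) = (c + g * i1) + (c + g * i2) by lia.
  exact: addpI.
have ss : cnt (addp A' A') 0 (m + m).+1 <= cnt (addp A A) 0 (M + M).+1.
  apply: (@cnt_inj _ _ (fun i => c + c + g * i)) => [i lei /sA' h|i1 i2 _ _ _ _ /eqP].
    split=> //; case/addpP: h => x1 [x2 [/bA h1 /bA h2 <-]]; lia.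
  by rewrite eqn_add2l eqn_pmul2l // => /eqP.
have gcdA' d : (forall i, A' i -> d %| i) -> d = 1.
  move=> dA; have : d * g %| g.
    apply/gP => x Ax; have [i _ e1] := cov _ Ax.
    by rewrite e1 addKn mulnC dvdn_pmul2l // dA // /A' -e1.
  rewrite -{2}[g]mul1n dvdn_pmul2r //; rewrite dvdn1 => /eqP //.
have dense : m + 3 <= cnt A' 0 m.+1 + cnt A' 0 m.+1.
  rewrite leqNgt; apply/negP => h.
  have := freiman_sparse A'0 A'm bA' gcdA'; rewrite k'k in h *.
  by clear -h ss small; lia.
have card := dense_addp_card (leqnn m) A'0 A'm A'0 A'm dense.
have small' : cnt (addp A' A') 0 (m + m).+1 + 4 <= cnt A' 0 m.+1 + 2 * cnt A' 0 m.+1.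
  by rewrite k'k; clear -ss small; lia.
have [lo [hi [full lohi]]] :=
  dense_addp_interval (leqnn m) A'0 A'm A'0 A'm dense small'.
have m_gt0 : 0 < m.
  case: posnP => // m0; have := cnt_le A' 0 m.+1; rewrite k'k m0.
  by clear -small; lia.
exists c, g, m, lo, hi; split; first by split.
split; last by rewrite k'k in lohi; clear -lohi; lia.
  by rewrite k'k in card; apply: leq_trans ss.
by move=> i /full /sA'.
Qed.

Lemma cnt_ends (A : pred nat) m : (forall x, A x -> x <= m) -> 0 < cnt A 0 m.+1 ->
  exists c d, [/\ A c, A (c + d), c + d <= m,
    forall x, A x -> c <= x <= c + d &
    cnt (fun i => A (c + i)) 0 d.+1 = cnt A 0 m.+1].
Proof.
move=> bA A_gt0.
have [a Aa] : exists a, A a.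
  case: (boolP (has A (iota 0 m.+1))) => [/hasP[a _ Aa]|/hasPn h]; first by exists a.
  by move: A_gt0; rewrite cnt_none // => x hx; apply: h; rewrite mem_iota.
have [c Ac minc] := ex_minnP (ex_intro _ a Aa).
have [e Ae maxe] := ex_maxnP (ex_intro _ a Aa) bA.
have le := minc _ Ae; have lem := bA _ Ae.
exists c, (e - c); rewrite subnKC //; split=> // [x Ax|].
  by rewrite minc ?maxe.
have -> : cnt (fun i => A (c + i)) 0 (e - c).+1 = cnt A c e.+1.
  have e1 : e.+1 = (e - c).+1 + c by lia.
  rewrite [in RHS]e1 -[X in cnt A X _]add0n cnt_shift.
  by apply: eq_cnt => x _; rewrite addnC.
have cem : c <= m.+1 by lia.
have cee : c <= e.+1 by lia.
rewrite (cnt_cat A (leq0n c) cem) (@cnt_cat A c e.+1 m.+1 cee lem).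
rewrite (@cnt_none A 0 c) => [|x hx]; last by apply/negP => /minc; lia.
rewrite (@cnt_none A e.+1 m.+1) ?addn0 // => x hx.
by apply/negP => /maxe; lia.
Qed.

(** Both sets are translated to start at 0 and the one of larger diameter is put first; since either
    may be it, density and smallness are assumed in both orders. *)
Lemma addp_interval (A B : pred nat) m n :
  (forall x, A x -> x <= m) -> (forall x, B x -> x <= n) ->
  0 < cnt A 0 m.+1 -> 0 < cnt B 0 n.+1 ->
  m + 3 <= cnt A 0 m.+1 + cnt B 0 n.+1 -> n + 3 <= cnt A 0 m.+1 + cnt B 0 n.+1 ->
  cnt (addp A B) 0 (m + n).+1 + 4 <= cnt A 0 m.+1 + 2 * cnt B 0 n.+1 ->
  cnt (addp A B) 0 (m + n).+1 + 4 <= 2 * cnt A 0 m.+1 + cnt B 0 n.+1 ->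
  exists lo hi, (forall x, lo <= x < hi -> addp A B x) /\
    lo + (cnt A 0 m.+1 + cnt B 0 n.+1) <= hi.+1.
Proof.
move=> bA bB A_gt0 B_gt0 dm dn s1 s2.
have [c [d [Ac Acd cdm _ cA]]] := cnt_ends bA A_gt0.
have [c' [d' [Bc Bcd cdn _ cB]]] := cnt_ends bB B_gt0.
pose A' : pred nat := fun i => A (c + i); pose B' : pred nat := fun i => B (c' + i).
have A'0 : A' 0 by rewrite /A' addn0.
have B'0 : B' 0 by rewrite /B' addn0.
have sub x : addp A' B' x -> addp A B (c + c' + x).
  by case/addpP=> x1 [x2 [h1 h2 <-]]; rewrite addnACA; apply: addpI.
have subc : cnt (addp A' B') 0 (d + d').+1 <= cnt (addp A B) 0 (m + n).+1.
  apply: leq_trans (_ : cnt (addp A B) (0 + (c + c')) ((d + d').+1 + (c + c')) <= _).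
    by apply: cnt_shift_le => x _ /sub; rewrite addnC.
  by apply: cnt_widen => //; clear -cdm cdn; lia.
rewrite -cA -cB in dm dn s1 s2 *.
have [lo [hi [full lohi]]] : exists lo hi, (forall x, lo <= x < hi -> addp A' B' x) /\
    lo + (cnt A' 0 d.+1 + cnt B' 0 d'.+1) <= hi.+1.
  case: (leqP d' d) => le.
    apply: (dense_addp_interval le) => //; rewrite -/A' -/B' in dm s1;
    by clear -subc dm s1 cdm; lia.
  have [||lo [hi [full lohi]]] := @dense_addp_interval B' A' d' d (ltnW le) B'0 Bcd A'0 Acd.
  - by rewrite -/A' -/B' in dn; clear -dn cdn; lia.
  - have -> : cnt (addp B' A') 0 (d' + d).+1 = cnt (addp A' B') 0 (d + d').+1.
      by rewrite addnC; apply: eq_cnt => x _; apply: addpC.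
    by rewrite -/A' -/B' in s2; clear -subc s2; lia.
  exists lo, hi; split; last by clear -lohi; lia.
  by move=> x /full; rewrite addpC.
exists (c + c' + lo), (c + c' + hi); split; last by rewrite -/A' -/B'; clear -lohi; lia.
move=> x hx; have -> : x = c + c' + (x - (c + c')) by clear -hx; lia.
by apply/sub/full; clear -hx; lia.
Qed.

(** * Cosine sums over half of a cyclic group *)

Local Open Scope ring_scope.

Lemma unitZp_prime (p : nat) (p_prime : prime p) (k : 'Z_p) :
  k != 0 -> k \is a GRing.unit.
Proof.
have p_gt1 := prime_gt1 p_prime.
move=> k0; rewrite -[k]natr_Zp unitZpE // prime_coprime //.
by apply: contra k0 => /dvdnP[q e]; rewrite -[k]natr_Zp e natrM pchar_Zp // mulr0.
Qed.

Lemma sum_Zp (p : nat) (p_gt1 : (1 < p)%N) (V : nmodType) (F : 'Z_p -> V) :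
  \sum_x F x = \sum_(i < p) F i%:R.
Proof.
pose G i := F i%:R.
rewrite -(big_mkord xpredT G) -[RHS](f_equal (fun n => \sum_(0 <= i < n) G i) (Zp_cast p_gt1)).
by rewrite big_mkord; apply: eq_bigr => x _; rewrite /G natr_Zp.
Qed.

Section CosineSums.

Variables (R : realType) (h : nat).
Let p := h.*2.+1.
Hypothesis h_gt0 : (0 < h)%N.

Definition angle : R := pi *+ 2 / p%:R.
Local Notation theta := angle.

Let p_gt0 : 0 < p%:R :> R. Proof. by rewrite ltr0n. Qed.

Let p_gt1 : (1 < p)%N. Proof. by rewrite /p; lia. Qed.

Lemma angle_mulp : theta * p%:R = pi *+ 2.
Proof. by rewrite /theta divfK // gt_eqF. Qed.

Let pE : p%:R = h%:R *+ 2 + 1 :> R.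
Proof. by rewrite /p -addn1 natrD -muln2 natrM mulr_natr. Qed.

Let hR : 1 <= h%:R :> R. Proof. by rewrite ler1n. Qed.

Lemma angle_gt0 : 0 < theta.
Proof. by rewrite /theta divr_gt0 // pmulrn_lgt0 // pi_gt0. Qed.

Lemma angle_mulh : theta * h%:R = pi - theta / 2.
Proof. have := angle_mulp; rewrite pE; lra. Qed.

Let sin_half_gt0 : 0 < sin (theta / 2).
Proof.
apply: sin_gt0_pi; apply/andP; split; first by have := angle_gt0; lra.
have := angle_mulh; have := angle_gt0; have := hR; nra.
Qed.

(** Multiplication by twice [sin (theta / 2)] makes the sum telescope. *)
Lemma sum_cos_arith (phi : R) n :
  (\sum_(i < n.+1) cos (phi + theta * i%:R)) * sin (theta / 2)
  = cos (phi + theta * n%:R / 2) * sin (theta * n.+1%:R / 2).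
Proof.
have prod (a b : R) : cos a * sin b *+ 2 = sin (a + b) - sin (a - b).
  rewrite !sinD cosN sinN; ring.
have tel : (\sum_(i < n.+1) cos (phi + theta * i%:R)) * sin (theta / 2) *+ 2
  = sin (phi + theta * n%:R + theta / 2) - sin (phi - theta / 2).
  elim: n => [|n IH].
    by rewrite big_ord1 /= mulr0n !mulr0 !addr0 prod.
  rewrite big_ord_recr /= mulrDl mulrnDl IH prod.
  have -> : phi + theta * n.+1%:R - theta / 2 = phi + theta * n%:R + theta / 2.
    by rewrite -natr1; field.
  by ring.
have : (\sum_(i < n.+1) cos (phi + theta * i%:R)) * sin (theta / 2) *+ 2
  = cos (phi + theta * n%:R / 2) * sin (theta * n.+1%:R / 2) *+ 2.
  by rewrite tel prod; congr (sin _ - sin _); rewrite -natr1; field.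
by move=> e; lra.
Qed.

(** The modulus of the sum of [h + 1] consecutive [p]-th roots of unity, a value of the Dirichlet
    kernel. *)
Definition kernel : R := sin (theta * h.+1%:R / 2) / sin (theta / 2).

Lemma sum_cos_half phi :
  \sum_(i < h.+1) cos (phi + theta * i%:R) = kernel * cos (phi + theta * h%:R / 2).
Proof.
apply: (mulIf (lt0r_neq0 sin_half_gt0)); rewrite sum_cos_arith /kernel.
by field; rewrite gt_eqF.
Qed.

Lemma kernel_gt0 : 0 < kernel.
Proof.
apply: divr_gt0 => //; apply: sin_gt0_pi; rewrite -natr1.
have := angle_mulh; have := angle_gt0; have := hR; have := @pi_gt0 R.
move=> h1 h2 h3 h4; apply/andP; split; nra.
Qed.

Lemma sum_cos_full phi : \sum_(i < p) cos (phi + theta * i%:R) = 0.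
Proof.
apply: (mulIf (lt0r_neq0 sin_half_gt0)); rewrite sum_cos_arith mul0r angle_mulp.
by have -> : pi *+ 2 / 2 = pi :> R; [lra|rewrite sinpi mulr0].
Qed.

Lemma cos_mod phi n : cos (phi + theta * (n %% p)%N%:R) = cos (phi + theta * n%:R).
Proof.
have -> : phi + theta * n%:R
    = phi + theta * (n %% p)%N%:R + (pi *+ 2) *+ (n %/ p)%N.
  rewrite {1}(divn_eq n p) natrD natrM -[X in _ + _ + X]mulr_natr -angle_mulp.
  by ring.
by rewrite (periodicn (@cosD2pi R)).
Qed.

Lemma cosZp_nat phi n : cos (phi + theta * (n%:R : 'Z_p)%:R) = cos (phi + theta * n%:R).
Proof. by rewrite val_Zp_nat // cos_mod. Qed.

Lemma cosZpD phi (x y : 'Z_p) :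
  cos (phi + theta * (x + y)%R%:R) = cos (phi + theta * x%:R + theta * y%:R).
Proof.
rewrite -{1}[x]natr_Zp -{1}[y]natr_Zp -natrD cosZp_nat.
by rewrite natrD mulrDr addrA.
Qed.

Lemma sum_cosZp phi : \sum_(x : 'Z_p) cos (phi + theta * x%:R) = 0.
Proof.
rewrite (sum_Zp p_gt1) -[RHS](sum_cos_full phi).
by apply: eq_bigr => i _; rewrite cosZp_nat.
Qed.

End CosineSums.

(** * Cosine sums of a set bounded by its counts in half-circles *)

Section HalfCircles.
Variables (R : realType) (h : nat).
Let p := h.*2.+1.
Hypothesis h_gt0 : (0 < h)%N.
Local Notation theta := (angle R h).
Local Notation kernel := (kernel R h).
Let p_gt1 : (1 < p)%N. Proof. by rewrite /p; lia. Qed.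

Lemma sum_cosZpM (X : {set 'Z_p}) (F : 'Z_p -> R) :
  \sum_(x in X) F x = \sum_x (x \in X)%:R * F x.
Proof. by rewrite big_mkcond; apply: eq_bigr => x _; rewrite mulr_natl mulrb. Qed.

(** After a rotation, [h] consecutive cosines are nonnegative and the next [h] nonpositive; only the
    sign at the starting point is open. The starting point joined to the block of its own sign gives
    [h + 1] consecutive terms, of sum at most [kernel] in absolute value, and the total sum is
    zero. *)
Lemma sum_abs_cosZp phi : \sum_(x : 'Z_p) `|cos (phi + theta * x%:R)| <= kernel *+ 2.
Proof.
have t0 := angle_gt0 R h; have th := angle_mulh R h; have pi0 := @pi_gt0 R; have pi2 := @pi_ge2 R.
(* Full turns are subtracted from [phi] so that [q] below is nonnegative and [Num.trunc] is its
   floor. *)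
pose n := Num.bound (`|phi| + pi).
have ltn : `|phi| + pi < n%:R by apply: archi_boundP; rewrite addr_ge0 // ltW.
pose psi := phi - (pi *+ 2) * n%:R.
have cpsi y : cos (phi + y) = cos (psi + y).
  by rewrite -(periodicn (@cosD2pi R) n (psi + y)) /psi -mulr_natr; congr cos; ring.
have psi_le : psi <= - pi.
  have : phi <= `|phi| by exact: ler_norm.
  have : n%:R <= (pi *+ 2) * n%:R :> R.
    by rewrite ler_peMl ?ler0n //; lra.
  rewrite /psi; lra.
(* This choice puts the starting point [x0] within [theta / 2] of [- pi / 2]. *)
pose q := (- (pi / 2) + theta / 2 - psi) / theta.
have q_ge0 : 0 <= q by rewrite divr_ge0 ?ltW //; lra.
have /andP[] := truncn_itv q_ge0; set s0 := Num.trunc q => le_s0 lt_s0.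
rewrite ler_pdivlMr // in le_s0; rewrite -natr1 ltr_pdivrMr // in lt_s0.
pose x0 := psi + theta * s0%:R.
have -> : \sum_(x : 'Z_p) `|cos (phi + theta * x%:R)|
   = \sum_(0 <= i < p) `|cos (x0 + theta * i%:R)|.
  rewrite (reindex_inj (addrI (s0%:R : 'Z_p))) /= (sum_Zp p_gt1) big_mkord.
  apply: eq_bigr => i _; rewrite cosZpD // cosZp_nat // addrAC cosZp_nat //.
  by rewrite addrAC -addrA cpsi addrA.
have hp : (h.+1 <= p)%N by rewrite /p; lia.
rewrite (big_cat_nat (leq0n _) hp) /= big_ltn // mulr0n mulr0 addr0.
have low i : (1 <= i < h.+1)%N -> 0 <= cos (x0 + theta * i%:R).
  move=> /andP[i1]; rewrite ltnS => ih; apply: cos_ge0_pihalf.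
  have r1 : 1 <= i%:R :> R by rewrite ler1n.
  have r2 : i%:R <= h%:R :> R by rewrite ler_nat.
  have r3 : theta <= theta * i%:R by rewrite ler_peMr // ltW.
  have r4 : theta * i%:R <= theta * h%:R by rewrite ler_pM2l.
  rewrite /x0; apply/andP; split; lra.
have high i : (h.+1 <= i < p)%N -> cos (x0 + theta * i%:R) <= 0.
  move=> /andP[hi1 hi2]; rewrite -[X in cos X](subrK pi) cosDpi oppr_le0.
  apply: cos_ge0_pihalf.
  have r1 : h.+1%:R <= i%:R :> R by rewrite ler_nat.
  have r2 : i%:R <= h.*2%:R :> R by rewrite ler_nat; move: hi2; rewrite /p ltnS.
  have r3 : theta * h.+1%:R <= theta * i%:R by rewrite ler_pM2l.
  have r4 : theta * i%:R <= theta * h.*2%:R by rewrite ler_pM2l.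
  rewrite -natr1 mulrDr mulr1 in r3.
  rewrite -muln2 natrM mulrA in r4.
  rewrite /x0; apply/andP; split; lra.
set U := \sum_(1 <= i < h.+1) `|_|; set V := \sum_(h.+1 <= i < p) `|_|.
have UE : U = \sum_(1 <= i < h.+1) cos (x0 + theta * i%:R).
  by apply: eq_big_nat => i /low hi; rewrite ger0_norm.
have VE : V = - \sum_(h.+1 <= i < p) cos (x0 + theta * i%:R).
  by rewrite -sumrN; apply: eq_big_nat => i /high hi; rewrite ler0_norm.
have first : cos x0 + U = kernel * cos (x0 + theta * h%:R / 2).
  rewrite -sum_cos_half // -(big_mkord xpredT (fun i => cos (x0 + theta * i%:R))).
  by rewrite big_ltn // mulr0n mulr0 addr0 UE.
have total : cos x0 + U - V = 0.
  rewrite VE opprK UE -[RHS](sum_cos_full h_gt0 x0).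
  rewrite -(big_mkord xpredT (fun i => cos (x0 + theta * i%:R))).
  by rewrite [RHS](big_cat_nat (leq0n _) hp) /= [in RHS]big_ltn // mulr0n mulr0 addr0.
(* The block runs from [h + 1] to [p]; the index [p] closes the circle and contributes [cos x0]. *)
have last : cos x0 - V = kernel * cos (x0 + theta * h.+1%:R + theta * h%:R / 2).
  rewrite -sum_cos_half // VE opprK.
  have -> : \sum_(i < h.+1) cos (x0 + theta * h.+1%:R + theta * i%:R)
     = \sum_(h.+1 <= i < p.+1) cos (x0 + theta * i%:R).
    rewrite -[X in \sum_(X <= i < _) _]add0n big_addn.
    have -> : (p.+1 - h.+1 = h.+1)%N by rewrite /p; lia.
    by rewrite big_mkord; apply: eq_bigr => i _; rewrite natrD; congr cos; ring.
  rewrite [RHS]big_nat_recr /=; last exact: hp.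
  rewrite addrC; congr (_ + _).
  by rewrite angle_mulp cosD2pi.
have k0 := kernel_gt0 R h_gt0.
have c1 y : kernel * cos y <= kernel by rewrite ler_piMr ?cos_le1 // ltW.
have c2 y : - kernel <= kernel * cos y.
  by rewrite -mulrN1 ler_pM2l // cos_geN1.
have b1 := c1 (x0 + theta * h%:R / 2); rewrite -first in b1.
have b2 := c2 (x0 + theta * h.+1%:R + theta * h%:R / 2); rewrite -last in b2.
by have [hc|hc] := ger0P (cos x0); lra.
Qed.

(* Up to the factor [kernel], the cosine sum of [X] is that of the function
   [s |-> #|X :&: [s, s + h]|], which stays within [a - #|X| / 2] of [#|X| / 2]. *)
Section HalfInterval.

Variables (X : {set 'Z_p}) (a : nat).
Hypothesis max_a : forall s : 'Z_p, (\sum_(i < h.+1) ((s + i%:R)%R \in X) <= a)%N.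

(** Two consecutive half-circles have [p + 1] terms together; [s] is both the first and the last. *)
Lemma card_split s : (\sum_(i < h.+1) ((s + i%:R)%R \in X) +
  \sum_(i < h.+1) ((s + h.+1%:R + i%:R)%R \in X) = #|X| + (s \in X))%N.
Proof.
have -> : #|X| = (\sum_(0 <= i < p) ((s + i%:R)%R \in X))%N.
  rewrite -sum1_card big_mkcond (reindex_inj (addrI s)) /= big_mkord.
  rewrite (sum_Zp p_gt1 (fun x : 'Z_p => if s + x \in X then 1%N else 0%N)).
  by apply: eq_bigr => i _; case: (_ \in X).
have p0 : (p%:R = 0 :> 'Z_p) by rewrite pchar_Zp.
have -> : (\sum_(0 <= i < p) ((s + i%:R)%R \in X) + (s \in X)
    = \sum_(0 <= i < p.+1) ((s + i%:R)%R \in X))%N.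
  by rewrite [RHS]big_nat_recr //= p0 addr0.
have hp : (h.+1 <= p.+1)%N by rewrite /p; lia.
rewrite [RHS](big_cat_nat (leq0n _) hp) /= big_mkord; congr (_ + _)%N.
rewrite -[X in \sum_(X <= i < _) _]add0n big_addn.
have -> : (p.+1 - h.+1 = h.+1)%N by rewrite /p; lia.
by rewrite big_mkord; apply: eq_bigr => i _; rewrite natrD addrA addrAC.
Qed.

Lemma half_interval_count : (#|X| <= a.*2)%N.
Proof.
rewrite -addnn; apply: leq_trans (leq_add (max_a 0) (max_a (0 + h.+1%:R))).
by rewrite card_split leq_addr.
Qed.

Lemma cos_sum_le phi : \sum_(x in X) cos (phi + theta * x%:R) <= a.*2%:R - #|X|%:R.
Proof.
pose F (s : 'Z_p) : R := \sum_(i < h.+1) ((s + i%:R)%R \in X)%:R.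
(* The shift cancels the phase [theta * h / 2] of a sum over a half-circle. *)
pose psi := phi + theta * h%:R / 2.
have k0 := kernel_gt0 R h_gt0.
have conv : \sum_s F s * cos (psi + theta * s%:R)
   = kernel * \sum_(x in X) cos (phi + theta * x%:R).
  rewrite mulr_sumr sum_cosZpM.
  under eq_bigr do rewrite mulr_suml.
  rewrite exchange_big /=.
  transitivity (\sum_(i < h.+1) \sum_(x : 'Z_p) (x \in X)%:R *
     cos (- (psi + theta * x%:R) + theta * i%:R)).
    apply: eq_bigr => i _.
    have key (x : 'Z_p) : cos (psi + theta * x%:R) =
        cos (- (psi + theta * (x + i%:R)%R%:R) + theta * i%:R).
      rewrite -[RHS]cosN opprD opprK [in RHS]addrAC cosZpD // cosZp_nat //.
      by congr cos; ring.
    rewrite [RHS](reindex_inj (addIr (i%:R : 'Z_p))); cbv beta.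
    by apply: eq_bigr => x _; congr (_ * _); apply: key.
  rewrite exchange_big /=; apply: eq_bigr => x _.
  rewrite -mulr_sumr sum_cos_half //; congr (_ * (_ * _)).
  by rewrite -cosN /psi; congr cos; field.
have zero : \sum_(s : 'Z_p) cos (psi + theta * s%:R) = 0 by apply: sum_cosZp.
(* A half-circle and its successor each hold at most [a] elements and together at least [#|X|], so
   [F] lies between [#|X| - a] and [a]. *)
pose g : R := a%:R - #|X|%:R / 2.
have Fg s : `|F s - #|X|%:R / 2| <= g.
  have FE : F s = (\sum_(i < h.+1) ((s + i%:R)%R \in X))%N%:R by rewrite natr_sum.
  have := card_split s; have := max_a s; have := max_a (s + h.+1%:R).
  rewrite -!(ler_nat R) -FE => h1 h2 /(f_equal (fun n : nat => n%:R : R)).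
  rewrite !natrD -FE => h3; have : 0 <= (s \in X)%:R :> R by rewrite ler0n.
  rewrite /g ler_norml => h4; apply/andP; split; lra.
have : kernel * \sum_(x in X) cos (phi + theta * x%:R) <= g * (kernel *+ 2).
  rewrite -conv.
  have -> : \sum_s F s * cos (psi + theta * s%:R)
     = \sum_s (F s - #|X|%:R / 2) * cos (psi + theta * s%:R).
    under [RHS]eq_bigr do rewrite mulrBl.
    by rewrite sumrB -mulr_sumr zero mulr0 subr0.
  have g0 : 0 <= g by apply: le_trans (Fg 0).
  apply: (@le_trans _ _ (g * \sum_(s : 'Z_p) `|cos (psi + theta * s%:R)|)).
    rewrite mulr_sumr; apply: ler_sum => s _.
    by apply: le_trans (ler_norm _) _; rewrite normrM ler_wpM2r.
  by rewrite ler_wpM2l // sum_abs_cosZp.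
have -> : g * (kernel *+ 2) = kernel * (a.*2%:R - #|X|%:R).
  by rewrite /g -muln2 natrM; field.
by rewrite ler_pM2l.
Qed.

End HalfInterval.
End HalfCircles.

(** * Fourier coefficients and small sumsets *)

Section Fourier.

Variables (R : realType) (h : nat).
Let p := h.*2.+1.
Hypothesis p_prime : prime p.
Local Notation theta := (angle R h).

Let p_gt1 : (1 < p)%N. Proof. exact: prime_gt1. Qed.
Let h_gt0 : (0 < h)%N. Proof. by move: p_gt1; rewrite /p; lia. Qed.

(** Real and imaginary parts of an additive character of ['Z_p]; the Fourier analysis stays in real
    arithmetic. *)
Definition cZ (x : 'Z_p) : R := cos (theta * x%:R).
Definition sZ (x : 'Z_p) : R := sin (theta * x%:R).

Let cos_cs phi (x : 'Z_p) : cos (phi + theta * x%:R) = cos phi * cZ x - sin phi * sZ x.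
Proof. exact: cosD. Qed.

Let sZE x : sZ x = cos (- (pi / 2) + theta * x%:R).
Proof. by rewrite addrC cosBpihalf. Qed.

Let cZE x : cZ x = cos (0 + theta * x%:R).
Proof. by rewrite add0r. Qed.

Lemma cZD x y : cZ (x + y) = cZ x * cZ y - sZ x * sZ y.
Proof. by rewrite cZE cosZpD // add0r cosD. Qed.

Lemma sZD x y : sZ (x + y) = sZ x * cZ y + cZ x * sZ y.
Proof. by rewrite sZE cosZpD // -addrA addrC cosBpihalf sinD. Qed.

Lemma cZ0 : cZ 0 = 1. Proof. by rewrite /cZ mulr0n mulr0 cos0. Qed.
Lemma sZ0 : sZ 0 = 0. Proof. by rewrite /sZ mulr0n mulr0 sin0. Qed.

Lemma csZ1 x : cZ x ^+ 2 + sZ x ^+ 2 = 1. Proof. exact: cos2Dsin2. Qed.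

Lemma cZN x : cZ (- x) = cZ x.
Proof.
have h1 : cZ (x - x) = 1 by rewrite subrr cZ0.
have h2 : sZ (x - x) = 0 by rewrite subrr sZ0.
rewrite cZD in h1; rewrite sZD in h2.
rewrite -[LHS]mul1r -(csZ1 x) -[RHS]mulr1 -h1.
have -> : (cZ x ^+ 2 + sZ x ^+ 2) * cZ (- x)
  = cZ x * (cZ x * cZ (- x) - sZ x * sZ (- x))
    + sZ x * (sZ x * cZ (- x) + cZ x * sZ (- x)) by ring.
by rewrite h2 mulr0 addr0.
Qed.

Lemma sZN x : sZ (- x) = - sZ x.
Proof.
have h1 : cZ (x - x) = 1 by rewrite subrr cZ0.
have h2 : sZ (x - x) = 0 by rewrite subrr sZ0.
rewrite cZD in h1; rewrite sZD in h2.
rewrite -[LHS]mul1r -(csZ1 x) -[RHS]mulr1 -h1.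
have -> : (cZ x ^+ 2 + sZ x ^+ 2) * sZ (- x)
  = cZ x * (sZ x * cZ (- x) + cZ x * sZ (- x))
    - sZ x * (cZ x * cZ (- x) - sZ x * sZ (- x)) by ring.
by rewrite h2 mulr0 add0r mulNr.
Qed.

Lemma sum_cZ z : \sum_(k : 'Z_p) cZ (k * z) = (z == 0)%:R * p%:R.
Proof.
have [->|z0] := eqVneq z 0.
  rewrite mul1r (eq_bigr (fun=> 1)) => [|k _]; last by rewrite mulr0 cZ0.
  by rewrite sumr_const card_ord Zp_cast.
rewrite mul0r -[RHS](@sum_cosZp R h h_gt0 0).
rewrite [RHS](reindex_inj (mulIr (unitZp_prime p_prime z0))).
by apply: eq_bigr => k _; rewrite cZE.
Qed.

(** Real and imaginary parts of the Fourier coefficient of [X] at [k]. *)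
Definition cS (X : {set 'Z_p}) k := \sum_(x in X) cZ (k * x).
Definition sS (X : {set 'Z_p}) k := \sum_(x in X) sZ (k * x).

Lemma parseval (X : {set 'Z_p}) :
  \sum_k (cS X k ^+ 2 + sS X k ^+ 2) = p%:R * #|X|%:R.
Proof.
transitivity (\sum_(k : 'Z_p) \sum_(x in X) \sum_(y in X) cZ (k * (x - y))).
  apply: eq_bigr => k _; rewrite !expr2 /cS /sS !big_distrlr /= -big_split /=.
  apply: eq_bigr => x _; rewrite -big_split /=; apply: eq_bigr => y _.
  by rewrite mulrBr cZD cZN sZN mulrN opprK.
rewrite exchange_big -[#|X|]sum1_card natr_sum mulr_sumr.
apply: eq_bigr => x Xx; rewrite exchange_big.
transitivity (\sum_(y in X) (x - y == 0)%:R * p%:R : R).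
  by apply: eq_bigr => y _; apply: sum_cZ.
rewrite (bigD1 x) // subrr eqxx mul1r mulr1.
rewrite big1 => [|y /andP[_ neyx]]; first exact: addr0.
by rewrite subr_eq0 eq_sym (negbTE neyx) mul0r.
Qed.

Lemma big_distrlr3 (A B : {set 'Z_p}) (f g w : 'Z_p -> R) :
  (\sum_(x in A) f x) * (\sum_(y in A) g y) * (\sum_(z in B) w z)
  = \sum_(x in A) \sum_(y in A) \sum_(z in B) f x * g y * w z.
Proof.
by rewrite big_distrlr mulr_suml; apply: eq_bigr => x _; apply: big_distrlr.
Qed.

(** The summand is the real part of the squared coefficient of [A] times the conjugate coefficient
    of [B]. By orthogonality the sum is [p] times the number of solutions of [x + y = z], one for
    each pair in [A]. *)
Lemma triple_sum (A B : {set 'Z_p}) :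
  (forall x y, x \in A -> y \in A -> x + y \in B) ->
  \sum_k ((cS A k ^+ 2 - sS A k ^+ 2) * cS B k + cS A k * sS A k * sS B k *+ 2)
    = p%:R * #|A|%:R ^+ 2.
Proof.
move=> AB.
transitivity (\sum_(k : 'Z_p) \sum_(x in A) \sum_(y in A) \sum_(z in B) cZ (k * (x + y - z))).
  apply: eq_bigr => k _.
  have -> : (cS A k ^+ 2 - sS A k ^+ 2) * cS B k + cS A k * sS A k * sS B k *+ 2
    = cS A k * cS A k * cS B k - sS A k * sS A k * cS B k
      + sS A k * cS A k * sS B k + cS A k * sS A k * sS B k by ring.
  rewrite /cS /sS !big_distrlr3 -sumrB -!big_split; apply: eq_bigr => x _.
  rewrite -sumrB -!big_split; apply: eq_bigr => y _.
  rewrite -sumrB -!big_split; apply: eq_bigr => z _.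
  have -> : cZ (k * (x + y - z)) = cZ (k * x) * cZ (k * y) * cZ (k * z)
      - sZ (k * x) * sZ (k * y) * cZ (k * z) + sZ (k * x) * cZ (k * y) * sZ (k * z)
      + cZ (k * x) * sZ (k * y) * sZ (k * z).
    by rewrite mulrBr mulrDr [cZ (_ - _)]cZD cZN sZN cZD sZD; ring.
  by [].
rewrite exchange_big.
have -> : p%:R * #|A|%:R ^+ 2 = \sum_(x in A) \sum_(y in A) (p%:R : R).
  rewrite (eq_bigr (fun=> p%:R * #|A|%:R)) => [|x _].
    by rewrite sumr_const -[RHS]mulr_natr; ring.
  by rewrite sumr_const mulr_natr.
apply: eq_bigr => x Ax; rewrite exchange_big; apply: eq_bigr => y Ay.
rewrite exchange_big.
transitivity (\sum_(z in B) (x + y - z == 0)%:R * p%:R : R).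
  by apply: eq_bigr => z _; apply: sum_cZ.
rewrite (bigD1 (x + y)) ?AB // subrr eqxx mul1r.
rewrite big1 => [|z /andP[_ nez]]; first exact: addr0.
by rewrite subr_eq0 eq_sym (negbTE nez) mul0r.
Qed.

Variables (A B : {set 'Z_p}) (a : nat).
Hypothesis AB : forall x y, x \in A -> y \in A -> x + y \in B.
Hypothesis max_a : forall g s : 'Z_p, g != 0 ->
  (\sum_(i < h.+1) ((s + g *+ i)%R \in A) <= a)%N.

(** Dilation by [k] turns progressions of difference [k^-1] into intervals, so the half-circle bound
    applies to [k A]. *)
Lemma dilate_bounds k : k != 0 ->
  (#|A| <= a.*2)%N /\
  forall phi, \sum_(x in A) cos (phi + theta * (k * x)%R%:R) <= a.*2%:R - #|A|%:R.
Proof.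
move=> k0; have uk := unitZp_prime p_prime k0.
pose X : {set 'Z_p} := [set k * x | x in A].
have injk : injective ( *%R k) by apply: mulrI.
have cX : #|X| = #|A| by rewrite card_imset.
have maxX s : (\sum_(i < h.+1) ((s + i%:R)%R \in X) <= a)%N.
  have ki0 : k^-1 != 0 by rewrite invr_neq0.
  apply: leq_trans (max_a (k^-1 * s) ki0); apply: leq_sum => i _.
  have -> : s + i%:R = k * (k^-1 * s + k^-1 *+ i).
    by rewrite mulrDr mulVKr // mulrnAr divrr.
  by rewrite mem_imset.
split; first by rewrite -cX; exact: (half_interval_count h_gt0 maxX).
move=> phi; rewrite -cX; apply: le_trans (cos_sum_le h_gt0 maxX phi).
by rewrite big_imset //= => x y _ _ /injk.
Qed.

Local Notation M := (a.*2%:R - #|A|%:R : R).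

(** A suitable phase rotates the coefficient onto the positive real axis, where its modulus is one
    of the bounded cosine sums. *)
Lemma norm_bound k : k != 0 -> cS A k ^+ 2 + sS A k ^+ 2 <= M ^+ 2.
Proof.
move=> k0; have [_ hb] := dilate_bounds k0.
set C := cS A k; set S := sS A k.
have lin phi : cos phi * C - sin phi * S <= M.
  apply: le_trans (hb phi); rewrite /C /S /cS /sS !mulr_sumr -sumrB.
  by apply: ler_sum => x _; rewrite cos_cs.
have [P0|P0] := eqVneq (C ^+ 2 + S ^+ 2) 0; first by rewrite P0 sqr_ge0.
have P_gt0 : 0 < C ^+ 2 + S ^+ 2 by rewrite lt_neqAle eq_sym P0 addr_ge0 ?sqr_ge0.
pose rho := Num.sqrt (C ^+ 2 + S ^+ 2).
have rho_gt0 : 0 < rho by rewrite sqrtr_gt0.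
have rho2 : rho ^+ 2 = C ^+ 2 + S ^+ 2 by rewrite sqr_sqrtr // ltW.
have u1 : (C / rho) ^+ 2 + (S / rho) ^+ 2 = 1.
  by rewrite !expr_div_n -mulrDl -rho2 divff // expf_neq0 // gt_eqF.
have Crange : -1 <= C / rho <= 1.
  rewrite -ler_norml -[leRHS](normr1 R) -ler_sqr ?nnegrE //.
  by rewrite !real_normK ?num_real // expr1n -u1 lerDl sqr_ge0.
have sinE : sin (acos (C / rho)) = `|S / rho|.
  rewrite sin_acos // -u1 addrAC subrr add0r sqrtr_sqr //.
have : rho <= M.
  have rhoE : rho = (C / rho) * C + (S / rho) * S.
    have e : rho * rho = C * C + S * S by rewrite -!expr2 rho2.
    by apply: (mulIf (lt0r_neq0 rho_gt0)); rewrite e; field; rewrite gt_eqF.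
  rewrite {1}rhoE.
  (* The sine of an [acos] is nonnegative, so the sign of [S] decides the sign of the phase. *)
  have [Sp|Sn] := lerP 0 (S / rho).
    have := lin (- acos (C / rho)).
    by rewrite cosN sinN acosK ?in_itv //= sinE ger0_norm // mulNr opprK.
  have := lin (acos (C / rho)).
  by rewrite acosK ?in_itv //= sinE ltr0_norm // mulNr opprK.
move=> le; rewrite -rho2 ler_sqr ?nnegrE //; first exact: ltW.
by apply: le_trans le; apply: ltW.
Qed.

(** Cauchy-Schwarz over [k != 0]: [W] is at most the squared modulus for [A] times the modulus for
    [B], one factor for [A] is bounded by [M], and Parseval evaluates the rest. *)
Lemma fourier_bound : A != set0 -> (#|B| < p)%N ->
  #|A|%:R ^+ 3 * (p%:R - #|B|%:R) <= M ^+ 2 * #|B|%:R * (p%:R - #|A|%:R).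
Proof.
move=> A0 ltBp.
have N_gt0 : 0 < #|A|%:R :> R by rewrite ltr0n card_gt0.
have leAB : (#|A| <= #|B|)%N.
  have [x Ax] := set0Pn _ A0.
  rewrite -(card_imset (mem A) (addrI x)); apply: subset_leq_card.
  by apply/subsetP => _ /imsetP[y Ay ->]; apply: AB.
have pB : 0 < p%:R - #|B|%:R :> R by rewrite subr_gt0 ltr_nat.
have pA : 0 < p%:R - #|A|%:R :> R by rewrite subr_gt0 ltr_nat (leq_ltn_trans leAB).
have M_ge0 : 0 <= M.
  by rewrite subr_ge0 ler_nat; have [] := @dilate_bounds 1 (oner_neq0 _).
pose W k := (cS A k ^+ 2 - sS A k ^+ 2) * cS B k + cS A k * sS A k * sS B k *+ 2.
pose P k := cS A k ^+ 2 + sS A k ^+ 2.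
pose Q k := cS B k ^+ 2 + sS B k ^+ 2.
have c0 (X : {set 'Z_p}) : cS X 0 = #|X|%:R.
  rewrite /cS (eq_bigr (fun=> 1)) => [|x _]; last by rewrite mul0r cZ0.
  by rewrite sumr_const.
have s0 (X : {set 'Z_p}) : sS X 0 = 0.
  by rewrite /sS big1 // => x _; rewrite mul0r sZ0.
have sumP : \sum_(k | k != 0) P k = #|A|%:R * (p%:R - #|A|%:R).
  by have := parseval A; rewrite (bigD1 0) //= c0 s0 -/(P _) => e; rewrite /P; lra.
have sumQ : \sum_(k | k != 0) Q k = #|B|%:R * (p%:R - #|B|%:R).
  by have := parseval B; rewrite (bigD1 0) //= c0 s0 => e; rewrite /Q; lra.
have sumW : \sum_(k | k != 0) W k = #|A|%:R ^+ 2 * (p%:R - #|B|%:R).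
  have := triple_sum AB; rewrite (bigD1 0) //= !c0 !s0 => e; rewrite /W; lra.
have P_ge0 k : 0 <= P k by rewrite addr_ge0 ?sqr_ge0.
have Q_ge0 k : 0 <= Q k by rewrite addr_ge0 ?sqr_ge0.
(* [W] is the real part of a product of squared modulus [P ^ 2 * Q]; the difference is the square of
   its imaginary part. *)
have WPQ k : W k ^+ 2 <= P k ^+ 2 * Q k.
  rewrite -subr_ge0.
  have -> : P k ^+ 2 * Q k - W k ^+ 2 =
    ((cS A k ^+ 2 - sS A k ^+ 2) * sS B k - cS A k * sS A k * cS B k *+ 2) ^+ 2.
    by rewrite /P /Q /W; ring.
  exact: sqr_ge0.
set N : R := #|A|%:R in N_gt0 pA sumP sumW *.
set T : R := #|B|%:R in pB sumQ sumW *.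
(* AM-GM weights with [u ^ 2 * \sum P = v ^ 2 * \sum Q] in the extremal case. *)
pose u := N * (p%:R - T); pose v := M * (p%:R - N).
have u_ge0 : 0 <= u by rewrite mulr_ge0 // ltW.
have v_ge0 : 0 <= v by rewrite mulr_ge0 // ltW.
have termwise k : k != 0 -> 2 * u * v * W k <= M * (u ^+ 2 * P k + v ^+ 2 * Q k).
  move=> k0; have hP := norm_bound k0; rewrite -/(P k) in hP.
  have rhs0 : 0 <= M * (u ^+ 2 * P k + v ^+ 2 * Q k).
    by rewrite mulr_ge0 // addr_ge0 // mulr_ge0 // sqr_ge0.
  have [le0|gt0] := lerP (2 * u * v * W k) 0; first exact: le_trans rhs0.
  rewrite -ler_sqr ?nnegrE //; last exact: ltW.
  apply: (@le_trans _ _ ((2 * u * v) ^+ 2 * (M ^+ 2 * P k * Q k))).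
    rewrite exprMn ler_wpM2l ?sqr_ge0 //; apply: le_trans (WPQ k) _.
    by rewrite ler_wpM2r // expr2 ler_wpM2r.
  rewrite -subr_ge0.
  have -> : (M * (u ^+ 2 * P k + v ^+ 2 * Q k)) ^+ 2 - (2 * u * v) ^+ 2 * (M ^+ 2 * P k * Q k)
     = (M * (u ^+ 2 * P k - v ^+ 2 * Q k)) ^+ 2 by ring.
  exact: sqr_ge0.
have total : 2 * u * v * (N ^+ 2 * (p%:R - T))
   <= M * (u ^+ 2 * (N * (p%:R - N)) + v ^+ 2 * (T * (p%:R - T))).
  rewrite -sumP -sumQ -sumW !mulr_sumr -big_split /= mulr_sumr.
  by apply: ler_sum => k k0; apply: termwise.
have M_gt0 : 0 < M.
  rewrite lt_neqAle M_ge0 andbT; apply/eqP => M0.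
  have : \sum_(k | k != 0) W k <= 0.
    apply: sumr_le0 => k k0; have := norm_bound k0; rewrite -/(P k) -M0 expr0n /= => hP.
    have P0 : P k = 0 by apply/eqP; rewrite eq_le hP P_ge0.
    have := WPQ k; rewrite P0 expr0n /= mul0r => hW.
    have : W k ^+ 2 == 0 by rewrite eq_le hW sqr_ge0.
    by rewrite sqrf_eq0 => /eqP ->.
  rewrite sumW; apply/negP; rewrite -ltNge mulr_gt0 // exprn_gt0 //.
have D_gt0 : 0 < M * (p%:R - N) * (p%:R - T) by rewrite !mulr_gt0.
rewrite -(ler_pM2l D_gt0) -subr_ge0.
have -> : M * (p%:R - N) * (p%:R - T) * (M ^+ 2 * T * (p%:R - N))
   - M * (p%:R - N) * (p%:R - T) * (N ^+ 3 * (p%:R - T))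
  = M * (u ^+ 2 * (N * (p%:R - N)) + v ^+ 2 * (T * (p%:R - T)))
    - 2 * u * v * (N ^+ 2 * (p%:R - T)) by rewrite /u /v; ring.
by rewrite subr_ge0.
Qed.

End Fourier.

(** * Arithmetic progressions modulo a prime *)

(* With [|A'| = a], the cubic makes [(2 a - N)^2 T (p - N) >= N^3 (p - T)] force
   [3 a >= T + 4], the range of Freiman's theorem for [A']: substituting the
   extreme values [3 a = T + 3 = (2 + alpha) N] and [4 T = 3 p] gives
   [(1 + 2 alpha)^2 (5 + 4 alpha) = 9], which is the cubic again. *)
Lemma cubic_density (R : realFieldType) (alpha : R) (N T p a : nat) :
  4 * alpha ^+ 3 + 9 * alpha ^+ 2 + 6 * alpha - 1 = 0 ->
  T%:R <= (2 + alpha) * N%:R - 3 -> (4 * T <= 3 * p)%N ->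
  (0 < N)%N -> (N <= T)%N -> (N <= a.*2)%N ->
  (N ^ 3 * (p - T) <= (a.*2 - N) ^ 2 * T * (p - N))%N ->
  (T + 4 <= 3 * a)%N.
Proof.
move=> cubic hT Tp N_gt0 NT Na four; rewrite leqNgt; apply/negP => lt.
have lta : (3 * a <= T + 3)%N by lia.
have ltTp : (T < p)%N by lia.
have n_gt0 : 0 < N%:R :> R by rewrite ltr0n.
have ltp : T%:R < p%:R :> R by rewrite ltr_nat.
have Np := leq_trans NT (ltnW ltTp).
have fourR : N%:R ^+ 3 * (p%:R - T%:R)
    <= (a%:R * 2 - N%:R) ^+ 2 * T%:R * (p%:R - N%:R) :> R.
  have -> : a%:R * 2 = a.*2%:R :> R by rewrite -muln2 natrM.
  by rewrite -!natrB ?(ltnW ltTp) // -!natrX -!natrM ler_nat.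
move: lta Tp NT Na; rewrite -!(ler_nat R) !natrM -muln2 natrM natrD.
clear four; move: fourR hT n_gt0 ltp.
set n : R := N%:R; set t : R := T%:R; set q : R := p%:R; set b : R := a%:R.
move=> four hT n_gt0 ltp lta Tp NT Na.
(* The value of [3 (2 a - N) / N] at the extreme [3 a = (2 + alpha) N]. *)
pose beta := 1 + 2 * alpha.
have D_ge0 : 0 <= b * 2 - n by lra.
have Dle : 3 * (b * 2 - n) <= beta * n by rewrite /beta; nra.
have beta_ge0 : 0 <= beta by nra.
have sq : 9 * (b * 2 - n) ^+ 2 <= beta ^+ 2 * n ^+ 2.
  have -> : 9 * (b * 2 - n) ^+ 2 = (3 * (b * 2 - n)) ^+ 2 by ring.
  rewrite -exprMn ler_sqr ?nnegrE //; apply: mulr_ge0 => //; exact: ltW.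
have t_gt0 : 0 < t by lra.
have tq : 0 < t * (q - n) by apply: mulr_gt0 => //; lra.
have step1 : 9 * n * (q - t) <= beta ^+ 2 * t * (q - n).
  have n2 : 0 < n ^+ 2 by apply: exprn_gt0.
  rewrite -(ler_pM2l n2).
  have h1 : 9 * (b * 2 - n) ^+ 2 * (t * (q - n)) <= beta ^+ 2 * n ^+ 2 * (t * (q - n)).
    by rewrite ler_wpM2r // ltW.
  lra.
(* The quotient [(q - t) / (q - n)] is least at the extreme [q = 4 t / 3]. *)
have step2 : 3 * n * t * (q - n) <= 9 * n * (q - t) * (4 * t / 3 - n).
  rewrite -subr_ge0.
  have -> : 9 * n * (q - t) * (4 * t / 3 - n) - 3 * n * t * (q - n)
     = 9 * n * ((t - n) * (q - 4 * t / 3)) by field.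
  by rewrite !mulr_ge0 //; lra.
have step3 : 9 * n <= beta ^+ 2 * (4 * t - 3 * n).
  have h1 : 9 * n * (q - t) * (4 * t / 3 - n) <= beta ^+ 2 * t * (q - n) * (4 * t / 3 - n).
    by rewrite ler_wpM2r //; lra.
  rewrite -(ler_pM2l tq); lra.
have cub : beta ^+ 2 * (5 + 4 * alpha) = 9 by rewrite /beta; lra.
have h2 : beta ^+ 2 * (4 * t - 3 * n) <= beta ^+ 2 * ((5 + 4 * alpha) * n - 12).
  by rewrite ler_wpM2l ?sqr_ge0 //; lra.
(* The constant -3 in the bound on [T] leaves the slack [12 * beta ^+ 2]. *)
have b0 : beta ^+ 2 <= 0.
  have e : beta ^+ 2 * ((5 + 4 * alpha) * n - 12) = 9 * n - 12 * beta ^+ 2.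
    by rewrite mulrBr mulrA cub [12 * _]mulrC.
  lra.
have b0' : beta ^+ 2 = 0 by apply/eqP; rewrite eq_le b0 sqr_ge0.
by move: cub; rewrite b0' mul0r; lra.
Qed.

Section Progressions.

Variables (p : nat).
Hypothesis p_prime : prime p.
Let p_gt1 : (1 < p)%N. Proof. exact: prime_gt1. Qed.

Lemma Zp_natr_inj i j : (i < p)%N -> (j < p)%N -> i%:R = j%:R :> 'Z_p -> i = j.
Proof.
by move=> hi hj /(f_equal val); rewrite /= !val_Zp_nat // !modn_small.
Qed.

Lemma AP_inj (c g : 'Z_p) i j : g != 0 -> (i < p)%N -> (j < p)%N ->
  c + g *+ i = c + g *+ j -> i = j.
Proof.
move=> g0 hi hj /addrI; rewrite -[g *+ i]mulr_natr -[g *+ j]mulr_natr.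
by move=> /(mulrI (unitZp_prime p_prime g0)); apply: Zp_natr_inj.
Qed.

Lemma AP_surj (c g x : 'Z_p) : g != 0 -> exists2 i, (i < p)%N & x = c + g *+ i.
Proof.
move=> g0; exists (val (g^-1 * (x - c))).
  exact: leq_trans (ltn_ord _) (eq_leq (Zp_cast p_gt1)).
by rewrite -mulr_natr natr_Zp mulVKr ?unitZp_prime // addrC subrK.
Qed.

Lemma cnt_AP (X : {set 'Z_p}) c g : g != 0 -> cnt (fun i => c + g *+ i \in X) 0 p = #|X|.
Proof.
move=> g0; rewrite -sum1_card big_mkcond /= /cnt big_mkord.
rewrite (reindex_inj (addrI c)) (reindex_inj (mulrI (unitZp_prime p_prime g0))) (sum_Zp p_gt1).
apply: eq_bigr => i _; cbv beta; rewrite mulr_natr; by case: (_ \in X).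
Qed.

Lemma card_AP (c g : 'Z_p) k : g != 0 -> (k <= p)%N ->
  #|[set c + g *+ (val i) | i : 'I_k]| = k.
Proof.
move=> g0 kp; rewrite card_imset ?card_ord // => i j e; apply: val_inj.
by apply: (AP_inj g0 _ _ e); apply: leq_trans kp; apply: ltn_ord.
Qed.

Lemma sumset_mem (A : {set 'Z_p}) x y : x \in A -> y \in A -> x + y \in sumset A.
Proof. by move=> Ax Ay; apply: imset2_f. Qed.

Variables (h : nat) (A : {set 'Z_p}).
Hypothesis p_odd : p = h.*2.+1.

Local Notation N := #|A|.
Local Notation T := #|sumset A|.
Local Notation inA c g := (fun i => c + g *+ i \in A).

(** Sums of two indices up to [h] stay below [p], so on this half progression addition is that of
    integers. The last clause says that the new progression captures at least as many elements of
    [A]. *)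
Lemma rectified_3k4 (c g : 'Z_p) : g != 0 ->
  (T + 4 <= 3 * cnt (inA c g) 0 h.+1)%N ->
  exists c' g' m lo hi,
    [/\ g' != 0, forall i, (i <= h)%N -> c + g *+ i \in A ->
          exists2 i', (i' <= m)%N & c + g *+ i = c' + g' *+ i',
        (m + cnt (inA c g) 0 h.+1 <= T)%N,
        forall i, (lo <= i < hi)%N -> c' + c' + g' *+ i \in sumset A &
        (lo + 2 * cnt (inA c g) 0 h.+1 <= hi.+1)%N] /\
    (cnt (inA c g) 0 h.+1 <= cnt (inA c' g') 0 m.+1)%N.
Proof.
move=> g0 small.
pose P : pred nat := fun i => (i <= h)%N && (c + g *+ i \in A).
have kE : cnt P 0 h.+1 = cnt (inA c g) 0 h.+1.
  by apply: eq_cnt => i /andP[_]; rewrite /P ltnS => ->.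
have bP i : P i -> (i <= h)%N by case/andP.
have PS i : addp P P i -> (c + c) + g *+ i \in sumset A.
  case/addpP=> i1 [i2 [/andP[_ h1] /andP[_ h2] <-]].
  by rewrite mulrnDr addrACA; apply: sumset_mem.
have SE : (cnt (addp P P) 0 (h + h).+1 <= T)%N.
  have -> : (h + h).+1 = p by rewrite p_odd addnn.
  rewrite -(cnt_AP (sumset A) (c + c) g0).
  by apply: cnt_sub => i _ /PS.
have small' : (cnt (addp P P) 0 (h + h).+1 + 4 <= 3 * cnt P 0 h.+1)%N.
  by rewrite kE; apply: leq_trans small; rewrite leq_add2r.
have [c1 [g1 [m [lo [hi [[g1_gt0 m_gt0 Pend cov] [h1 h2 h3]]]]]]] :=
  three_k_minus_four bP small'.
(* This keeps the new difference [g *+ g1] nonzero. *)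
have lt_g1 : (g1 < p)%N.
  have := bP _ Pend; have : (g1 <= g1 * m)%N by rewrite leq_pmulr.
  by rewrite p_odd; clear; lia.
have cg i : c + g *+ c1 + g *+ g1 *+ i = c + g *+ (c1 + g1 * i).
  by rewrite mulrnDr mulrnA addrA.
exists (c + g *+ c1), (g *+ g1), m, lo, hi; split; last first.
  rewrite -kE; apply: (@cnt_inj _ _ (fun x => (x - c1) %/ g1)%N) => [x _ Px|x y _ _ Px Py].
    have [i lei xE] := cov _ Px; rewrite xE addKn mulKn // ltnS lei cg -xE.
    by case/andP: Px.
  have [i _ ->] := cov _ Px; have [j _ ->] := cov _ Py.
  by rewrite !addKn !mulKn // => ->.
split.
- rewrite -mulr_natr mulrI_eq0; last by apply: mulrI; apply: unitZp_prime.
  apply/eqP => e; have := @Zp_natr_inj g1 0 lt_g1 (ltnW p_gt1) e.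
  by move: g1_gt0; case: (g1).
- move=> i lei Ai; have [|i' lei' e] := cov i; first by rewrite /P lei.
  by exists i' => //; rewrite cg -e.
- by rewrite -kE; apply: leq_trans SE.
- move=> i /h2 /PS; rewrite !mulrnDr mulrnA.
  by rewrite !addrA [c + c + _]addrAC -!addrA.
- by rewrite -kE.
Qed.

Hypothesis (h_T : (4 * T <= 3 * p)%N).

(* The complement [C] of [2A] lies in a short progression because [2A'] fills a
   long one, and [A' - C] misses [-A]; a long progression in [A' - C] therefore
   confines the whole of [A]. *)
Lemma half_AP_cover (c g : 'Z_p) m lo hi k : g != 0 ->
  (k <= cnt (inA c g) 0 m.+1)%N -> (m + k <= T)%N ->
  (forall i, (lo <= i < hi)%N -> c + c + g *+ i \in sumset A) ->
  (lo + 2 * k <= hi.+1)%N -> (T + 4 <= 3 * k)%N -> (k < N)%N -> (N <= T)%N ->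
  exists x0, forall x, x \in A -> exists2 i, (i <= h)%N & x = x0 + g *+ i.
Proof.
move=> g0 kA mT full lohi T3k kN NT.
set a2 := cnt _ 0 m.+1 in kA.
have km : (k <= m.+1)%N by apply: leq_trans kA _; rewrite -[m.+1]subn0 cnt_le.
have k_gt0 : (0 < k)%N by clear -T3k; lia.
have gp n : (-g) *+ (n + p) = (-g) *+ n.
  by rewrite mulrnDr -[X in _ + X]mulr_natr pchar_Zp // mulr0 addr0.
have ng0 : - g != 0 by rewrite oppr_eq0.
(* [y0] precedes the progression inside [2A], so going down from it the complement has indices at
   most [p - 2k]. Then [z - g (i1 + i2)] is an element of the complement minus one of [A']. *)
pose y0 := c + c + g *+ lo - g; pose z := y0 - c.
pose A2 : pred nat := fun i => (i <= m)%N && (c + g *+ i \in A).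
pose D : pred nat := fun i => (i <= p - 2 * k)%N && (y0 + (- g) *+ i \in ~: sumset A).
have bA2 i : A2 i -> (i <= m)%N by case/andP.
have bD i : D i -> (i <= p - 2 * k)%N by case/andP.
have cA2 : cnt A2 0 m.+1 = a2 by apply: eq_cnt => i /andP[_]; rewrite /A2 ltnS => ->.
have cC (X : {set 'Z_p}) : #|~: X| = (p - #|X|)%N.
  by rewrite cardsCs setCK (_ : #|'Z_p| = p) // card_ord Zp_cast.
have cD : cnt D 0 (p - 2 * k).+1 = (p - T)%N.
  rewrite -cC -(cnt_AP _ y0 ng0).
  have le : ((p - 2 * k).+1 <= p)%N by clear -k_gt0 p_gt1; lia.
  rewrite (cnt_cat _ (leq0n _) le) [X in (_ + X)%N]cnt_none => [|i hi'].
    by rewrite addn0; apply: eq_cnt => i /andP[_]; rewrite /D ltnS => ->.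
  rewrite inE negbK.
  have -> : y0 + (- g) *+ i = c + c + g *+ (lo + (p - i.+1)).
    have eg : g *+ (p - i.+1) = - (g *+ i.+1).
      apply/eqP; rewrite -addr_eq0 -mulrnDr subnK; last by clear -hi'; lia.
      by rewrite -mulr_natr pchar_Zp // mulr0.
    rewrite mulrnDr eg mulrS mulNrn /y0 [- (g + _)]opprD.
    by ring.
  by apply: full; clear -hi' lohi k_gt0; lia.
have Sno x : addp A2 D x -> z + (- g) *+ x \in ~: A.
  case/addpP=> i1 [i2 [/andP[_ h1] /andP[_ h2] <-]].
  rewrite inE; apply: contraL h2 => h2; rewrite inE negbK.
  have -> : y0 + (- g) *+ i2 = (c + g *+ i1) + (z + (- g) *+ (i1 + i2)).
    by rewrite mulrnDr mulNrn /z; ring.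
  exact: sumset_mem.
(* As [m <= T - k <= 2k - 4], the sums of indices do not wrap around. *)
have mk : (m + (p - 2 * k) < p)%N by clear -mT T3k km p_gt1 h_T; lia.
have cS : (cnt (addp A2 D) 0 (m + (p - 2 * k)).+1 <= p - N)%N.
  rewrite -cC -(cnt_AP _ z ng0).
  apply: (@leq_trans (cnt (addp A2 D) 0 p)); first exact: cnt_widen.
  by apply: cnt_sub => x _; apply: Sno.
have [||||||lo' [hi' [fullS lohi']]] := @addp_interval A2 D m (p - 2 * k) bA2 bD;
  rewrite ?cA2 ?cD.
- by clear -kA k_gt0; lia.
- by clear -h_T p_gt1; lia.
- by clear -kA mT T3k h_T; lia.
- by clear -kA mT T3k h_T km; lia.
- by clear -cS kA mT T3k h_T kN NT; lia.
- by clear -cS kA mT T3k h_T kN NT; lia.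
rewrite cA2 cD in lohi'.
(* The [h] terms [z - g i] with [lo' <= i < lo' + h] miss [A]; counted upwards from this start, they
   are the terms of index above [h]. *)
exists (z + (- g) *+ (lo' + p.-1)) => x Ax.
have [j ltj xE] := AP_surj (z + (- g) *+ (lo' + p.-1)) x g0.
exists j => //; rewrite leqNgt; apply/negP => ltj2.
have : z + (- g) *+ (lo' + (p.-1 - j)) \in ~: A.
  apply: Sno; apply: fullS.
  by clear -ltj ltj2 lohi' kA T3k h_T p_odd; lia.
rewrite inE; apply/negP; rewrite negbK.
suff -> : z + (- g) *+ (lo' + (p.-1 - j)) = x by [].
have e : (lo' + p.-1 = lo' + (p.-1 - j) + j)%N by clear -ltj; lia.
by rewrite xE e [in RHS]mulrnDr [(- g) *+ j]mulNrn [in RHS]addrA addrNK.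
Qed.

Lemma half_AP_conclusion (c g : 'Z_p) : g != 0 -> (T + 4 <= 3 * N)%N -> (N <= T)%N ->
  (forall x, x \in A -> exists2 i, (i <= h)%N & x = c + g *+ i) ->
  let r : int := (#|sumset A|%:Z - 2 * #|A|%:Z)%R in
  exists (g : 'Z_p) (PA P2A : {set 'Z_p}),
    g != 0%R /\ is_AP g PA /\ is_AP g P2A /\
    A \subset PA /\
    ((#|PA|)%:Z <= (#|A|)%:Z + r + 1)%R /\
    P2A \subset sumset A /\
    (2 * #|A| - 1 <= #|P2A|)%N.
Proof.
move=> g0 T3N NT cov.
have hp : (h.+1 <= p)%N by rewrite p_odd; lia.
have NE : cnt (inA c g) 0 h.+1 = N.
  rewrite -(cnt_AP A c g0) (cnt_cat _ (leq0n h.+1) hp).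
  rewrite [X in (_ = _ + X)%N]cnt_none ?addn0 // => i /andP[hi1 hi2].
  apply/negP => /cov[j lej e].
  have := AP_inj g0 hi2 (leq_trans _ hp) e; lia.
have Nh : (N <= h.+1)%N by rewrite -NE; have := cnt_le (inA c g) 0 h.+1; rewrite subn0.
have [|c' [g' [m [lo [hi [[g'0 cov' mN full lohi] _]]]]]] := @rectified_3k4 c g g0.
  by rewrite NE.
rewrite NE in mN lohi.
(* [m + N <= T] says that the [m + 1] terms of the first progression number at most [N + r + 1]; the
   second consists of the first [2N - 1] terms of the run found in [2A]. *)
exists g', [set c' + g' *+ (val i) | i : 'I_m.+1],
  [set (c' + c' + g' *+ lo) + g' *+ (val i) | i : 'I_(2 * N - 1)].
have mp : (m.+1 <= p)%N by clear -mN h_T T3N; lia.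
have N2p : (2 * N - 1 <= p)%N by clear -Nh p_odd; lia.
have N_gt0 : (0 < N)%N by clear -T3N; lia.
do ?split=> //.
- by exists c', m.+1; rewrite mp.
- by exists (c' + c' + g' *+ lo), (2 * N - 1)%N; rewrite N2p; split=> //; clear -N_gt0; lia.
- apply/subsetP => x Ax; have [i lei xE] := cov _ Ax.
  have [|i' lei' e] := cov' i lei; first by rewrite -xE.
  by apply/imsetP; exists (Ordinal (lei' : (i' < m.+1)%N)); rewrite // xE e.
- by rewrite card_AP //; clear -mN; lia.
- apply/subsetP => _ /imsetP[i _ ->]; rewrite -addrA -mulrnDr; apply: full.
  rewrite leq_addr; apply: (@leq_trans (lo + (2 * N - 1))).
    by rewrite -addnS leq_add2l ltn_ord.
  by clear -N_gt0 lohi; lia.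
- by rewrite card_AP.
Qed.

End Progressions.

(** * Assembly: the richest half progression and the final case distinction *)

Lemma sumset_card_ge (p : nat) (A : {set 'Z_p}) : (#|A| <= #|sumset A|)%N.
Proof.
have [->|[x Ax]] := set_0Vmem A; first by rewrite cards0.
rewrite -(card_imset (mem A) (addrI x)); apply: subset_leq_card.
by apply/subsetP => _ /imsetP[y Ay ->]; apply: sumset_mem.
Qed.

(** Start and difference are chosen to maximise the count. The conclusion is purely in natural
    numbers, so the trigonometry over concrete reals serves an arbitrary real closed field. *)
Lemma best_half_progression (p h : nat) (p_prime : prime p) (A : {set 'Z_p}) :
  p = h.*2.+1 -> A != set0 -> (#|sumset A| < p)%N ->
  exists (c g : 'Z_p) (a : nat),
    [/\ g != 0, cnt (fun i => c + g *+ i \in A) 0 h.+1 = a, (#|A| <= a.*2)%N &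
     (#|A| ^ 3 * (p - #|sumset A|) <= (a.*2 - #|A|) ^ 2 * #|sumset A| * (p - #|A|))%N].
Proof.
move=> pE A0 ltTp; subst p.
have NT := sumset_card_ge A.
pose f (x : 'Z_(h.*2.+1) * 'Z_(h.*2.+1)) := (\sum_(i < h.+1) ((x.2 + x.1 *+ i)%R \in A))%N.
case: (@arg_maxnP _ (1, 0) (fun x => x.1 != 0) f (oner_neq0 _)) => -[g c] /= g0 maxf.
have max_a (g' s : 'Z_(h.*2.+1)) : g' != 0 ->
    (\sum_(i < h.+1) ((s + g' *+ i)%R \in A) <= f (g, c))%N.
  by move=> g'0; apply: (maxf (g', s)).
exists c, g, (f (g, c)); split=> //.
- by rewrite /cnt big_mkord.
- by have [] := dilate_bounds (Rdefinitions.R : realType) p_prime max_a (oner_neq0 _).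
have le2 : (#|A| <= (f (g, c)).*2)%N.
  by have [] := dilate_bounds (Rdefinitions.R : realType) p_prime max_a (oner_neq0 _).
have := fourier_bound (Rdefinitions.R : realType) p_prime (@sumset_mem _ A) max_a A0 ltTp.
rewrite -!natrB ?(ltnW ltTp) ?(leq_trans NT (ltnW ltTp)) //.
by rewrite -!natrX -!natrM ler_nat.
Qed.

Local Close Scope ring_scope.

Theorem theorem1p3 (p : nat) (Hp : prime p) (A : {set 'Z_p})
  (HA : A != set0)
  (R : rcfType) (alpha : R)
  (Halpha : (4 * alpha ^+ 3 + 9 * alpha ^+ 2 + 6 * alpha - 1 = 0)%R)
  (H1 : ((#|sumset A|)%:R <= (2 + alpha) * (#|A|)%:R - 3 :> R)%R)
  (H2 : (4 * #|sumset A| <= 3 * p)%N) :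
  let r : int := ((#|sumset A|)%:Z - 2 * (#|A|)%:Z)%R in
  exists (g : 'Z_p) (PA P2A : {set 'Z_p}),
    g != 0%R /\ is_AP g PA /\ is_AP g P2A /\
    A \subset PA /\
    ((#|PA|)%:Z <= (#|A|)%:Z + r + 1)%R /\
    P2A \subset sumset A /\
    (2 * #|A| - 1 <= #|P2A|)%N.
Proof.
set T := #|sumset A| in H1 H2 *; set N := #|A| in H1 *.
have N_gt0 : 0 < N by rewrite card_gt0.
have NT : N <= T := sumset_card_ge A.
have alpha_lt1 : (alpha < 1)%R.
  rewrite ltNge; apply/negP => h.
  have h2 : (1 <= alpha ^+ 2)%R by rewrite expr_ge1 // (le_trans ler01 h).
  have h3 : (1 <= alpha ^+ 3)%R by rewrite expr_ge1 // (le_trans ler01 h).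
  by lra.
(* For [N = 1] the hypothesis would give [1 <= alpha - 1]. *)
have N_gt1 : 1 < N.
  rewrite ltn_neqAle N_gt0 andbT; apply/eqP => N1.
  by move: NT H1; rewrite -N1 -(ler_nat R) => h1 h2; lra.
have [h pE] : exists h, p = h.*2.+1.
  have [p2|p_odd] := even_prime Hp; first by move: H2 NT N_gt1; rewrite p2; lia.
  by exists p./2; rewrite -[LHS]odd_double_half p_odd.
have ltTp : T < p by clear -H2 NT N_gt0; lia.
have [c [g [a [g0 aE Na four]]]] := best_half_progression Hp pE HA ltTp.
have T3a : T + 4 <= 3 * a := cubic_density Halpha H1 H2 N_gt0 NT Na four.
have hp : h.+1 <= p by clear -pE; lia.
have aN : a + cnt (fun i => (c + g *+ i)%R \in A) h.+1 p = N.
  by rewrite -aE -cnt_cat // cnt_AP.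
have T3N : T + 4 <= 3 * N by clear -aN T3a; lia.
(* Either the richest half progression misses part of [A] and a covering one must be found, or it
   already contains [A]. *)
have [lt_aN|le_Na] := ltnP a N.
  have small : T + 4 <= 3 * cnt (fun i => (c + g *+ i)%R \in A) 0 h.+1 by rewrite aE.
  have [c' [g' [m [lo [hi [[g'0 _ mT full lohi] ka]]]]]] := rectified_3k4 Hp pE g0 small.
  rewrite aE in mT lohi ka.
  have [x0 cov0] := half_AP_cover Hp pE H2 g'0 ka mT full lohi T3a lt_aN NT.
  exact: (half_AP_conclusion Hp pE H2 g'0 T3N NT cov0).
apply: (half_AP_conclusion Hp pE H2 g0 T3N NT (c := c)) => x Ax.
have [i ltip xE] := AP_surj Hp c x g0.
exists i => //; rewrite leqNgt; apply/negP => lthi.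
have : 0 < cnt (fun i => (c + g *+ i)%R \in A) h.+1 p.
  rewrite (cnt_cat _ (leqW lthi : h.+1 <= i.+1) ltip) cntS //.
  by rewrite -xE Ax; clear; lia.
by clear -aN le_Na; lia.
Qed.
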